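(* Let $A_p\in\mathbb{R}^{n\times n}$, $B_p\in\mathbb{R}^{n\times m}$ with $B_p$ of full column rank, and consider the plant $\dot x_p(t)=A_px_p(t)+B_pu(t)$, $x_p(0)=x_{p0}$, and the reference model $\dot x_r(t)=A_rx_r(t)+B_rr(t)$, $x_r(0)=x_{r0}$, $t\ge0$, where $A_r\in\mathbb{R}^{n\times n}$ is Hurwitz and $B_r\in\mathbb{R}^{n\times m}$. Suppose that there exist $K^*\in\mathbb{R}^{m\times n}$, $L^*\in\mathbb{R}^{m\times m}$ with $A_p+B_pK^*=A_r$ and $B_pL^*=B_r$. Let $\mathcal{S}=\{[A_1\ B_1],\dots,[A_N\ B_N]\}\subset\mathbb{R}^{n\times(n+m)}$ be an admissible corner set for $[A_p\ B_p]$, and suppose that for each $i\in\{1,\dots,N\}$ the matrices $K_i\in\mathbb{R}^{m\times n}$, $L_i\in\mathbb{R}^{m\times m}$ satisfy $A_i+B_iK_i=A_r$ and $B_iL_i=B_r$. Let the plant be controlled by $$u(t)=\hat K(t)x_p(t)+\hat L(t)r(t),$$ $$\hat K(t)=\hat B_p^\dagger(t)\sum_{i=1}^N\hat w_i(t)B_iK_i,\quad \hat L(t)=\hat B_p^\dagger(t)\sum_{i=1}^N\hat w_i(t)B_iL_i,\quad \hat B_p(t)=\sum_{i=1}^N\hat w_i(t)B_i,$$ with $\hat B_p^\dagger=(\hat B_p^\top\hat B_p)^{-1}\hat B_p^\top$, where $\hat w(t)$ is generated by the projected adaptive law described in the context with $\hat{\bar w}(0)\in\operatorname{int}(\Pi)$.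 Then for any initial condition $x_{p0}\in\mathbb{R}^n$ of the plant, any initial condition $x_{r0}\in\mathbb{R}^n$ of the reference model, and any piecewise continuous and bounded reference signal $r:[0,\infty)\to\mathbb{R}^m$, if the resulting closed-loop signal $\Phi$ is persistently exciting, then all closed-loop signals (namely $x_p,x_r,u,\Phi,z,z_i,\varepsilon_i,E,\hat w,\hat B_p,\hat K,\hat L$) are bounded on $[0,\infty)$ and $\lim_{t\to\infty}(x_p(t)-x_r(t))=0$.
   Context: Admissible corner set: a finite set $\mathcal{S}=\{[A_1\ B_1],\dots,[A_N\ B_N]\}$ with $A_i\in\mathbb{R}^{n\times n}$, $B_i\in\mathbb{R}^{n\times m}$ is admissible for $[A_p\ B_p]$ if (i) $[A_p\ B_p]$ lies in the relative interior of $\operatorname{conv}(\mathcal{S})$, and (ii) every convex combination of $B_1,\dots,B_N$ has full column rank. Write $\Theta_i=[A_i\ B_i]$. Signals: fix design constants $\lambda>0$, $\alpha>0$. Let $\phi_1(t)\in\mathbb{R}^n$, $\phi_2(t)\in\mathbb{R}^m$ solve $\dot\phi_1=-\lambda\phi_1+x_p$, $\dot\phi_2=-\lambda\phi_2+u$, $\phi_1(0)=0$, $\phi_2(0)=0$; set $\Phi=[\phi_1^\top,\phi_2^\top]^\top$ and $z(t)=-\lambda\phi_1(t)+x_p(t)$. Define $z_i(t)=\Theta_i\Phi(t)$, $m_s^2(t)=1+\alpha\|\Phi(t)\|^2$ (Euclidean norm), $\varepsilon_i(t)=\dfrac{z(t)-z_i(t)}{m_s^2(t)}$ for $i=1,\dots,N$,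 and the $n\times(N-1)$ matrix $E(t)=[\varepsilon_1(t)-\varepsilon_N(t)\ \ \cdots\ \ \varepsilon_{N-1}(t)-\varepsilon_N(t)]$. Projected adaptive law: let $\Pi=\{v\in[0,1]^{N-1}:\sum_{i=1}^{N-1}v_i\le1\}$ and let $\Gamma\in\mathbb{R}^{(N-1)\times(N-1)}$ be symmetric positive definite. The estimate $\hat w(t)=[\hat{\bar w}^\top(t),\hat w_N(t)]^\top$, $\hat{\bar w}=(\hat w_1,\dots,\hat w_{N-1})$, is generated by $$\dot{\hat{\bar w}}(t)=\operatorname{Pr}_{\Pi,\hat{\bar w}(t)}\big(-\Gamma(E^\top(t)E(t)\hat{\bar w}(t)+E^\top(t)\varepsilon_N(t))\big),\qquad \hat w_N(t)=1-\sum_{i=1}^{N-1}\hat w_i(t).$$ Here $\operatorname{Pr}_{\Pi,v}$ is the gradient-projection operator of adaptive control, which leaves the vector unchanged when $v\in\operatorname{int}\Pi$ or when the vector does not point out of $\Pi$, and otherwise removes the outward component in the $\Gamma$-weighted sense; precisely, for $v\in\Pi$, $\operatorname{Pr}_{\Pi,v}(y)$ is the unique minimizer of $(y'-y)^\top\Gamma^{-1}(y'-y)$ over $y'$ in the tangent cone of $\Pi$ at $v$. Solutions are understood as absolutely continuous functions on $[0,\infty)$ satisfying the equations for almost every $t$; $\Pi$ is positively invariant. Persistent excitation: $\Phi:[0,\infty)\to\mathbb{R}^k$ is persistently exciting if there exist $\alpha_{\Phi1},\alpha_{\Phi2},T_\Phi>0$ such that for every $t\ge0$, $\alpha_{\Phi1}I\preceq\int_t^{t+T_\Phi}\Phi(\tau)\Phi^\top(\tau)\,d\tau\preceq\alpha_{\Phi2}I$.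 *)

(* Defs.v *)
From HB Require Import structures.
From mathcomp Require Import all_boot all_order all_algebra.
From mathcomp Require Import all_classical all_reals all_analysis.
From mathcomp Require Import complex.

Set Implicit Arguments.
Unset Strict Implicit.
Unset Printing Implicit Defensive.

Import Order.TTheory GRing.Theory Num.Theory.
Import numFieldNormedType.Exports.

Local Open Scope classical_set_scope.
Local Open Scope ring_scope.

Definition hurwitz (R : realType) (n : nat) (A : 'M[R]_n) : Prop :=
  forall a : R[i], eigenvalue (map_mx (real_complex R) A) a -> complex.Re a < 0.

Definition full_column_rank (R : realType) (n m : nat) (B : 'M[R]_(n, m)) :
    Prop :=
  \rank B = m.

(* The Moore-Penrose inverse when B has full column rank. *)
Definition left_pinv (R : realType) (n m : nat) (B : 'M[R]_(n, m)) :
    'M[R]_(m, n) :=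
  invmx (B^T *m B) *m B^T.

Definition qform (R : realType) (n : nat) (M : 'M[R]_n) (v : 'cV[R]_n) : R :=
  (v^T *m M *m v) 0 0.

Definition spd (R : realType) (n : nat) (M : 'M[R]_n) : Prop :=
  M^T = M /\ forall v : 'cV[R]_n, v != 0 -> 0 < qform M v.

Definition loewner_le (R : realType) (n : nat) (M P : 'M[R]_n) : Prop :=
  forall v : 'cV[R]_n, 0 <= qform (P - M) v.

(* The library norm on matrices is the max-norm, hence this Euclidean one. *)
Definition sqnorm2 (R : realType) (n : nat) (v : 'cV[R]_n) : R :=
  \sum_i v i 0 ^+ 2.

Definition convex_weights (R : realType) (k : nat) (w : 'I_k -> R) : Prop :=
  (forall i, 0 <= w i) /\ \sum_i w i = 1.

Definition conv_hull (R : realType) (V : lmodType R) (S : set V) : set V :=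
  [set p | exists (k : nat) (x : 'I_k -> V) (w : 'I_k -> R),
    [/\ forall i, S (x i), convex_weights w & p = \sum_i w i *: x i]].

Definition affine_hull (R : realType) (V : lmodType R) (S : set V) : set V :=
  [set p | exists (k : nat) (x : 'I_k -> V) (w : 'I_k -> R),
    [/\ forall i, S (x i), \sum_i w i = 1 & p = \sum_i w i *: x i]].

Definition relative_interior (R : realType) (V : normedModType R)
    (C : set V) : set V :=
  [set p | affine_hull C p /\
    exists2 e : R, 0 < e &
      forall q, affine_hull C q -> `|q - p| < e -> C q].

Definition admissible (R : realType) (n m k : nat)
    (A : 'M[R]_n) (B : 'M[R]_(n, m))
    (As : 'I_k -> 'M[R]_n) (Bs : 'I_k -> 'M[R]_(n, m)) : Prop :=
  relative_interior (conv_hull (range (fun i => row_mx (As i) (Bs i))))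
    (row_mx A B) /\
  (forall w : 'I_k -> R, convex_weights w ->
    full_column_rank (\sum_i w i *: Bs i)).

(* The tangent cone of convex analysis: the closed cone generated by C - v. *)
Definition tangent_cone (R : realType) (V : normedModType R)
    (C : set V) (v : V) : set V :=
  closure [set d | exists (s : R) (p : V), [/\ 0 <= s, C p & d = s *: (p - v)]].

(* For Gamma positive definite and C convex and nonempty the minimizer exists
   and is unique. The projection is only meant for v in C; outside C the same
   formula serves as a total extension. *)
Definition grad_proj (R : realType) (k : nat) (Gamma : 'M[R]_k)
    (C : set 'cV[R]_k) (v y : 'cV[R]_k) : 'cV[R]_k :=
  get [set p | tangent_cone C v p /\
    forall q, tangent_cone C v q ->
      qform (invmx Gamma) (p - y) <= qform (invmx Gamma) (q - y)].

Definition corner_simplex (R : realType) (k : nat) : set 'cV[R]_k :=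
  [set v | (forall i, 0 <= v i 0 <= 1) /\ \sum_i v i 0 <= 1].

(* Lists of N elements are indexed by 'I_k.+1 with N = k.+1: the N-th element
   is at ord_max, and this enumerates the first N - 1 of them. *)
Definition init_ord (k : nat) (i : 'I_k) : 'I_k.+1 := widen_ord (leqnSn k) i.

Definition abs_continuous (R : realType) (V : normedModType R) (a b : R)
    (f : R -> V) : Prop :=
  forall e : R, 0 < e -> exists2 d : R, 0 < d &
    forall (k : nat) (s t : 'I_k -> R),
      (forall i, a <= s i /\ s i <= t i /\ t i <= b) ->
      (forall i j, i != j -> t i <= s j \/ t j <= s i) ->
      \sum_i (t i - s i) < d ->
      \sum_i `|f (t i) - f (s i)| < e.

(* Caratheodory solution of x' = g on [0, +oo): absolute continuity is required
   on compact intervals, as solutions may a priori be unbounded. Signals are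
   total functions on R of which only the values on [0, +oo) matter. *)
Definition ae_solution (R : realType) (V : normedModType R)
    (x g : R -> V) : Prop :=
  (forall b : R, 0 < b -> abs_continuous 0 b x) /\
  {ae (@lebesgue_measure R), forall t : R, 0 <= t -> is_derive t 1 x (g t)}.

Definition bounded_signal (R : realType) (V : normedModType R) (x : R -> V) :
    Prop :=
  [bounded x t | t in `[0, +oo[%classic].

(* Finitely many discontinuities in each bounded interval, with finite
   one-sided limits everywhere. *)
Definition piecewise_continuous (R : realType) (V : normedModType R)
    (x : R -> V) : Prop :=
  [/\ forall b : R,
        finite_set [set t | 0 < t < b /\ ~ {for t, continuous x}],
      forall t : R, 0 < t -> cvg (x s @[s --> t^'-]) &
      forall t : R, 0 <= t -> cvg (x s @[s --> t^'+])].

Definition gramian (R : realType) (k : nat) (Phi : R -> 'cV[R]_k) (t T : R) :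
    'M[R]_k :=
  \matrix_(i, j)
    \int[@lebesgue_measure R]_(tau in `[t, t + T]%classic)
      ((Phi tau *m (Phi tau)^T) i j).

Definition persistently_exciting (R : realType) (k : nat)
    (Phi : R -> 'cV[R]_k) : Prop :=
  exists a1 a2 T : R, [/\ 0 < a1, 0 < a2, 0 < T &
    forall t : R, 0 <= t ->
      loewner_le a1%:M (gramian Phi t T) /\
      loewner_le (gramian Phi t T) a2%:M].

(* Main.v *)
(** Write [z = [Ap Bp] Phi + d], where the filter transient satisfies
    [d' = - lambda d]. As the estimated weights stay in the simplex, the gains
    are bounded, so [|Phi|^2] has derivative at most affine in [|Phi|^2]; since
    its integrals over windows of fixed length are bounded by the upper
    excitation bound, [Phi] is bounded, and with it every signal.

    Let [v] be the error of the estimated weights with respect to weights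
    representing [[Ap Bp]]. The projection onto the tangent cone does not
    increase the derivative of [v^T Gamma^-1 v + |d|^2 / lambda], which is
    therefore at most [- (|E v|^2 + |d|^2)]. So the integral of
    [|E v|^2 + |d|^2] over windows of fixed length tends to zero. As the same
    quantity bounds [|v'|^2], [v] varies little on such windows, and the lower
    excitation bound yields the convergence of the estimate to [[Ap Bp]]. The
    gains then converge to [Kstar] and [Lstar], and the tracking error solves
    [e' = Ar e + p] with [p] vanishing.

    Solutions are only absolutely continuous, but all that is used of them is
    that an inequality between almost everywhere derivatives integrates; the
    integrals above are antiderivatives of continuous functions. *)
Require Import Defs.
From HB Require Import structures.
From mathcomp Require Import all_boot all_order all_algebra.
From mathcomp Require Import all_classical all_reals all_analysis.
From mathcomp Require Import complex ring lra.

Set Implicit Arguments.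
Unset Strict Implicit.
Unset Printing Implicit Defensive.

Import Order.TTheory GRing.Theory Num.Theory.
Import numFieldNormedType.Exports.

Local Open Scope classical_set_scope.
Local Open Scope ring_scope.

(** * Absolutely continuous functions *)

(** The error is normalized: up to sign, [E v] is the mismatch of the estimate with [[Ap Bp]],
    applied to [Phi] and divided by [ms2]. Its smallness says nothing about the mismatch while [Phi]
    may be unbounded. So the bound on [Phi] has to come first, and it may use of the adaptation only
    that the weights stay in the simplex.

    The filters start at zero but the plant does not, hence [d(0) = xp0], and even exact weights
    leave the error [d / ms2]. The term [|d|^2 / lambda] in the energy pays for it.

    Affinely dependent corners represent [[Ap Bp]] by many weights. The error [v] refers to one
    fixed choice and need not tend to zero; excitation acts only on the combination of corner
    differences with coefficients [v].

    Convergence goes through integrals over windows and never through pointwise limits of [|E v|],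
    so no uniform continuity of the integrand enters: on a late window the estimate is almost
    frozen, which is the situation that the excitation inequality speaks about. *)

Lemma cousin (R : realType) (P : R -> R -> Prop) (a b : R) : a <= b ->
  (forall x y z, x <= y -> y <= z -> P x y -> P y z -> P x z) ->
  (forall t, a <= t <= b -> exists2 d, 0 < d &
     forall x y, a <= x -> y <= b -> x <= t -> t <= y -> y - x < d -> P x y) ->
  P a b.
Proof.
move=> ab Ptrans Ploc.
(* The supremum of the points reachable from [a] is itself reached, by the local hypothesis there,
   and can be passed unless it is [b]. *)
pose S := [set x | a <= x <= b /\ P a x].
have Sa : S a.
  split; first by rewrite lexx.
  have [|d d0 Pd] := Ploc a; first by rewrite lexx.
  by apply: Pd => //; rewrite subrr.
have Sub : ubound S b by move=> x [/andP[]].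
have supS : has_sup S by split; [exists a|exists b].
pose c := sup S.
have ac : a <= c by exact: ub_le_sup (proj2 supS) _ Sa.
have cb : c <= b by apply: ge_sup => //; exists a.
have [|d d0 Pd] := Ploc c; first by rewrite ac cb.
have d20 : 0 < d / 2 by rewrite divr_gt0.
have [x [/andP[ax xb] Px] cx] := sup_adherent d20 supS.
have xc : x <= c by apply: ub_le_sup (proj2 supS) _ _; split => //; apply/andP.
rewrite -/c in cx.
have Pac : P a c.
  apply: (Ptrans a x c) => //; apply: Pd => //; lra.
have [bc|bc] := leP b c.
  by have <- : c = b by apply/le_anti; rewrite cb bc.
pose y := Num.min b (c + d / 2).
have cy : c < y by rewrite lt_min bc /=; lra.
have yb : y <= b by rewrite ge_min lexx.
have yd : y <= c + d / 2 by rewrite ge_min lexx orbT.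
have Sy : S y.
  split; first by rewrite yb andbT; lra.
  apply: (Ptrans a c y) => //; first exact: ltW.
  by apply: Pd => //; [exact: ltW|lra].
have := ub_le_sup (proj2 supS) Sy; rewrite -/c; lra.
Qed.

(** Splitting at [t] covers all short intervals around [t], wherever [t] lies in them; these are the
    steps that Cousin's lemma offers. *)
Lemma derive_nonpos_local (R : realType) (f : R -> R) (t g e : R) :
  is_derive t 1 f g -> g <= 0 -> 0 < e -> exists2 d, 0 < d &
  forall x y, x <= t -> t <= y -> y - x < d -> f y - f x <= e * (y - x).
Proof.
move=> fg g0 e0.
have [fd fE] := fg.
have : h^-1 *: (f (h *: 1 + t) - f t) @[h --> 0^'] --> g.
  by rewrite -fE; exact: fd.
move=> /cvgrPdist_lt /(_ _ e0) [d /= d0 dP].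
have key h : `|h| < d -> h != 0 -> h^-1 * (f (h + t) - f t) < e.
  move=> hd h0.
  have := dP h; rewrite /ball_ /= sub0r normrN => /(_ hd h0).
  rewrite /GRing.scale /= mulr1 ltr_norml => /andP[]; lra.
exists d => // x y xt ty yx.
have fy : f y - f t <= e * (y - t).
  have [->|yt] := eqVneq y t; first by rewrite !subrr mulr0.
  have yt0 : 0 < y - t by rewrite subr_gt0 lt_neqAle eq_sym yt.
  have := key (y - t); rewrite subrK gtr0_norm // subr_eq0 => /(_ _ yt).
  by rewrite ltr_pdivrMl // mulrC => H; apply/ltW/H; lra.
have fx : f t - f x <= e * (t - x).
  have [->|tx] := eqVneq x t; first by rewrite !subrr mulr0.
  have xt0 : 0 < t - x by rewrite subr_gt0 lt_neqAle tx.
  have := key (x - t); rewrite subrK distrC gtr0_norm // subr_eq0 => /(_ _ tx).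
  rewrite -[x - t]opprB invrN mulNr -mulrN opprB ltr_pdivrMl // mulrC => H.
  by apply/ltW/H; lra.
lra.
Qed.

Lemma null_set_open_cover (R : realType) (N : set R) (e : R) :
  (@lebesgue_measure R).-negligible N -> 0 < e ->
  exists U : set R, [/\ open U, N `<=` U & (lebesgue_measure U < e%:E)%E].
Proof.
move=> [D [mD D0 ND]] e0.
have D0' : (@lebesgue_measure R D < +oo)%E by rewrite D0 ltry.
have [U [oU DU muU]] := lebesgue_regularity_outer mD D0' e0.
exists U; split => //; first exact: subset_trans DU.
apply: le_lt_trans muU.
have mU : measurable U by exact: measurable_realfun.open_measurable.
have UD0 : lebesgue_measure (U `&` D) = 0%E.
  by apply: (@subset_measure0 _ _ _ lebesgue_measure _ D) => //; exact: measurableI.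
by rewrite -[leRHS]adde0 -UD0 -measureDI.
Qed.

(** Chains of intervals are glued by concatenation in the next proof, hence the passage from indexed
    families to ordered lists. *)
Lemma abs_continuous_seq (R : realType) (a b : R) (f : R -> R) (e : R) :
  abs_continuous a b f -> 0 < e -> exists2 d : R, 0 < d &
    forall l : seq (R * R),
      all (fun p => [&& a <= p.1, p.1 <= p.2 & p.2 <= b]) l ->
      pairwise (fun p q => p.2 <= q.1) l ->
      \sum_(p <- l) (p.2 - p.1) < d ->
      \sum_(p <- l) `|f p.2 - f p.1| < e.
Proof.
move=> acf e0; have [d d0 dP] := acf e e0; exists d => // l lab ldisj lsum.
pose x0 : R * R := (0, 0).
have := dP (size l) (fun i => (nth x0 l i).1) (fun i => (nth x0 l i).2).
rewrite -(big_mkord xpredT (fun i => (nth x0 l i).2 - (nth x0 l i).1)).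
rewrite -(big_mkord xpredT (fun i => `|f (nth x0 l i).2 - f (nth x0 l i).1|)).
rewrite -(big_nth x0 xpredT (fun p => p.2 - p.1)).
rewrite -(big_nth x0 xpredT (fun p => `|f p.2 - f p.1|)); apply => //.
- by move=> i; have /and3P := all_nthP x0 lab i (ltn_ord i); case.
- have /(pairwiseP x0) H := ldisj.
  move=> i j; rewrite -val_eqE neq_ltn => /orP[] ij.
    by left; apply: (H i j) => //; exact: ltn_ord.
  by right; apply: (H j i) => //; exact: ltn_ord.
Qed.

(* A chain of small increments in the sense of Cousin's lemma: on the steps
   around a point of the exceptional null set, covered by the open set [U], the
   increments are charged to intervals of total length at most [mu U]. *)
Lemma abs_continuous_nonincreasing (R : realType) (a b : R) (f g : R -> R) :
  a <= b -> abs_continuous a b f ->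
  {ae (@lebesgue_measure R), forall t, a <= t <= b ->
     is_derive t 1 f (g t) /\ g t <= 0} ->
  f b <= f a.
Proof.
move=> ab acf aef; apply/ler_addgt0Pr => e e0.
(* The [+ 1] keeps the denominator positive when [a = b]; still [e1 * (b - a) <= e / 2]. *)
pose e1 := e / (2 * (b - a + 1)).
have e10 : 0 < e1 by rewrite divr_gt0 // mulr_gt0 //; lra.
have e20 : 0 < e / 2 by rewrite divr_gt0.
have [d d0 dP] := abs_continuous_seq acf e20.
have [U [oU NU Ud]] := null_set_open_cover aef d0.
have mU : measurable U by exact: measurable_realfun.open_measurable.
(* Adjacent half-open intervals are disjoint, so [m] is exactly additive along a chain. *)
pose m (x y : R) := fine (lebesgue_measure (U `&` `[x, y[%classic)).
have mfin x y : lebesgue_measure (U `&` `[x, y[%classic) \is a fin_num.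
  rewrite ge0_fin_numE //.
  apply: le_lt_trans (lt_trans Ud (ltry d)).
  by apply: le_measure; rewrite ?inE //; exact: measurableI.
have mD x y z : x <= y -> y <= z -> m x z = m x y + m y z.
  move=> xy yz; rewrite /m -fineD //; congr fine.
  rewrite -measureU //; last 3 first.
  - exact: measurableI.
  - exact: measurableI.
  - rewrite -setIIr; apply/seteqP; split => // w [_] /=.
    by rewrite !in_itv /= => -[/andP[_ wy] /andP[yw _]]; move: wy yw;
      rewrite ltNge => /negP.
  rewrite -setIUr; congr (lebesgue_measure (_ `&` _)).
  by rewrite -itv_bndbnd_setU // bnd_simp.
pose P (x y : R) := x <= y -> exists l : seq (R * R),
  [/\ all (fun p => [&& x <= p.1, p.1 <= p.2 & p.2 <= y]) l,
      pairwise (fun p q => p.2 <= q.1) l,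
      \sum_(p <- l) (p.2 - p.1) <= m x y &
      f y - f x <= e1 * (y - x) + \sum_(p <- l) `|f p.2 - f p.1|].
have Pab : P a b.
  apply: cousin => //.
    move=> x y z xy yz /(_ xy) [l1 [a1 p1 s1 f1]] /(_ yz) [l2 [a2 p2 s2 f2]] xz.
    exists (l1 ++ l2); split.
    - rewrite all_cat; apply/andP; split.
        by apply: sub_all a1 => p /and3P[-> -> /= py]; exact: le_trans yz.
      by apply: sub_all a2 => p /and3P[yp -> -> /=]; rewrite andbT (le_trans xy).
    - rewrite pairwise_cat p1 p2 !andbT; apply/allrelP =>
      p q /(allP a1) /and3P[_ _ py].
      by move=> /(allP a2) /and3P[yq _ _]; exact: le_trans yq.
    - by rewrite big_cat /= (mD _ y) //; apply: lerD.
    - rewrite big_cat /=; lra.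
  move=> t tab.
  have [Ut|nUt] := pselect (U t).
    have /nbhs_ballP [d1 d10 d1P] : nbhs t U by exact: open_nbhs_nbhs.
    exists d1 => // x y ax yb xt ty yx xy; exists [:: (x, y)]; split => /=.
    - by rewrite !lexx xy.
    - by [].
    - rewrite big_seq1 /= /m setIidr ?lebesgue_measure_itv /=; last first.
        move=> w /=; rewrite in_itv /= => /andP[xw wy]; apply: d1P.
        by rewrite /ball /= ltr_norml; lra.
      by rewrite lte_fin; case: ltP => //= ?; lra.
    - rewrite big_seq1 /=.
      have : 0 <= e1 * (y - x) by rewrite mulr_ge0 ?subr_ge0 // ltW.
      have := ler_norm (f y - f x); lra.
  have [fd g0] : is_derive t 1 f (g t) /\ g t <= 0.
    by apply: contrapT => H; apply: nUt; apply: NU => /=;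
      exact/(contra_not _ H)/(fun h => h tab).
  have [d1 d10 d1P] := derive_nonpos_local fd g0 e10.
  exists d1 => // x y ax yb xt ty yx xy; exists [::]; split => //.
    by rewrite big_nil /m fine_ge0.
  by rewrite big_nil addr0; exact: d1P.
have [l [al pl sl fl]] := Pab ab.
have ml : \sum_(p <- l) (p.2 - p.1) < d.
  apply: le_lt_trans sl _; rewrite -lte_fin fineK //; apply: le_lt_trans Ud.
  by apply: le_measure; rewrite ?inE //; exact: measurableI.
have := dP _ al pl ml.
have : e1 * (b - a) <= e / 2.
  rewrite /e1 mulrAC ler_pdivrMr ?mulr_gt0 //; last lra.
  have : 0 <= e * (b - a) by rewrite mulr_ge0 //; lra.
  lra.
lra.
Qed.

Lemma lebesgue_aeS (R : realType) (P Q : R -> Prop) : (forall t, P t -> Q t) ->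
  {ae (@lebesgue_measure R), forall t, P t} ->
  {ae (@lebesgue_measure R), forall t, Q t}.
Proof.
move=> PQ; have F := @ae_filter_ringOfSetsType _ _ _ (@lebesgue_measure R).
by apply: (@filterS _ _ F) => t; exact: PQ.
Qed.

Lemma lebesgue_aeS2 (R : realType) (P Q S : R -> Prop) : (forall t, P t ->
  Q t -> S t) ->
  {ae (@lebesgue_measure R), forall t, P t} ->
  {ae (@lebesgue_measure R), forall t, Q t} ->
  {ae (@lebesgue_measure R), forall t, S t}.
Proof.
move=> PQ; have F := @ae_filter_ringOfSetsType _ _ _ (@lebesgue_measure R).
by apply: (@filterS2 _ _ F) => t; exact: PQ.
Qed.

(** * Caratheodory solutions: algebra and comparison *)

Section absolutely_continuous_solutions.
Context {R : realType}.
Implicit Types f g F G : R -> R.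

(* Signals are only meaningful on [0, +oo): they are extended to the left by
   their initial value. *)
Definition halfline_continuous (f : R -> R) : Prop :=
  continuous (fun t : R => f (Num.max 0 t)).

Lemma halfline_continuous_within f a b : halfline_continuous f -> 0 <= a ->
  {within `[a, b], continuous f}.
Proof.
move=> cf a0.
have : {within `[a, b], continuous (fun t => f (Num.max 0 t))}.
  exact: continuous_subspaceT.
apply: subspace_eq_continuous => x /set_mem /=; rewrite in_itv => /andP[ax _].
by congr (f _); apply: max_r; exact: le_trans a0 ax.
Qed.

Lemma halfline_continuous_bounded f b : halfline_continuous f -> 0 <= b ->
  exists2 M, 0 < M & forall t, 0 <= t <= b -> `|f t| <= M.
Proof.
move=> cf b0.
have cn : {within `[0, b], continuous (Num.norm \o f)}.
  by move=> x; apply: (@cvg_norm _ R); exact: halfline_continuous_within cf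
    (lexx 0) x.
have [c _ cM] := EVT_max b0 cn.
exists (`|f c| + 1) => [|t tb]; first by rewrite ltr_wpDl.
by apply: le_trans (cM _ _) _ => //; rewrite lerDl.
Qed.

Lemma halfline_continuousD f g : halfline_continuous f ->
  halfline_continuous g -> halfline_continuous (fun t => f t + g t).
Proof. by move=> cf cg x; apply: continuousD; [exact: cf|exact: cg]. Qed.

Lemma halfline_continuousM f g : halfline_continuous f ->
  halfline_continuous g -> halfline_continuous (fun t => f t * g t).
Proof. by move=> cf cg x; apply: continuousM; [exact: cf|exact: cg]. Qed.

Lemma halfline_continuous_cst (c : R) : halfline_continuous (fun=> c).
Proof. by move=> x; exact: cvg_cst. Qed.

Lemma halfline_continuousV f : (forall t, 0 <= t -> f t != 0) ->
  halfline_continuous f -> halfline_continuous (fun t => (f t)^-1).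
Proof.
by move=> f0 cf x; apply: continuousV; [apply: f0; rewrite le_max lexx|exact: cf].
Qed.

Lemma halfline_continuous_sum (I : Type) (r : seq I) (P : pred I) (h : I ->
  R -> R) :
  (forall i, halfline_continuous (h i)) ->
  halfline_continuous (fun t => \sum_(i <- r | P i) h i t).
Proof.
move=> ch; elim: r => [|i r IH].
  rewrite (_ : (fun t => _) = (fun=> 0)); first exact: halfline_continuous_cst.
  by apply/funext => t; rewrite big_nil.
rewrite (_ : (fun t => _) = (fun t => (if P i then h i t else 0) +
   \sum_(j <- r | P j) h j t)); last first.
  by apply/funext => t; rewrite big_cons; case: (P i); rewrite ?add0r.
apply: halfline_continuousD => //.
by case: (P i); [exact: ch|exact: halfline_continuous_cst].
Qed.

Lemma eq_halfline_continuous f g : (forall t, 0 <= t -> f t = g t) ->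
  halfline_continuous f -> halfline_continuous g.
Proof.
move=> fg; rewrite /halfline_continuous.
suff -> : (fun t => f (Num.max 0 t)) = (fun t => g (Num.max 0 t)) by [].
by apply/funext => t; rewrite fg // le_max lexx.
Qed.

Lemma abs_continuous_halfline f :
  (forall b, 0 < b -> abs_continuous 0 b f) -> halfline_continuous f.
Proof.
move=> acf x; apply/cvgrPdist_lt => /= e e0.
pose b := `|x| + 1.
have b0 : 0 < b by rewrite /b ltr_wpDl.
have [d d0 dP] := acf b b0 e e0.
have step s t : 0 <= s -> s <= t -> t <= b -> t - s < d -> `|f t - f s| < e.
  move=> s0 st tb ts; have := dP 1%N (fun=> s) (fun=> t).
  rewrite !big_ord1; apply => // i j.
  by rewrite (ord1 i) (ord1 j) eqxx.
have d1 : 0 < Num.min d 1 by rewrite lt_min d0 ltr01.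
near=> y.
have : `|x - y| < Num.min d 1 by near: y; exact: cvgr_dist_lt.
rewrite lt_min => /andP[xyd xy1].
have hmax u v : u <= v -> Num.max 0 v - Num.max 0 u <= v - u :> R.
  by move=> uv; case: (leP 0 v); case: (leP 0 u); lra.
have hmon u v : u <= v -> Num.max 0 u <= Num.max 0 v :> R.
  by move=> uv; case: (leP 0 v); case: (leP 0 u); lra.
have hb u : `|x - u| <= 1 -> Num.max 0 u <= b.
  rewrite /b ge_max; have := ler_norm x; have := normr_ge0 x.
  by rewrite ler_norml => ? ? /andP[? ?]; apply/andP; split; lra.
have p0 u : 0 <= Num.max 0 u :> R by rewrite le_max lexx.
have [xy|yx] := leP x y.
  rewrite distrC; apply: step => //; [exact: hmon|exact/hb/ltW|].
  by apply: le_lt_trans (hmax _ _ xy) _; rewrite distrC ger0_norm ?subr_ge0 //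
    in xyd.
apply: step => //; [exact/hmon/ltW|by apply: hb; rewrite subrr normr0|].
by apply: le_lt_trans (hmax _ _ (ltW yx)) _; rewrite ger0_norm ?subr_ge0 ?(ltW
  yx) // in xyd.
Unshelve. all: by end_near. Qed.

Lemma ae_solution_continuous f g : ae_solution f g -> halfline_continuous f.
Proof. by move=> [/abs_continuous_halfline]. Qed.

Lemma eq_ae_solution f F g G : (forall t, 0 <= t -> g t = G t) -> f = F ->
  ae_solution f g -> ae_solution F G.
Proof.
move=> gG <- [acf df]; split => //.
by apply: lebesgue_aeS df => t H t0; rewrite -gG //; exact: H.
Qed.

Lemma abs_continuousD a b f g : abs_continuous a b f -> abs_continuous a b g ->
  abs_continuous a b (fun t => f t + g t).
Proof.
move=> acf acg e e0; have e20 : 0 < e / 2 by rewrite divr_gt0.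
have [d1 d10 fd] := acf _ e20; have [d2 d20 gd] := acg _ e20.
exists (Num.min d1 d2) => [|k s t ab dis]; first by rewrite lt_min d10.
rewrite lt_min => /andP[sd1 sd2].
have := fd k s t ab dis sd1; have := gd k s t ab dis sd2.
have : \sum_(i < k) `|f (t i) + g (t i) - (f (s i) + g (s i))| <=
  \sum_(i < k) `|f (t i) - f (s i)| + \sum_(i < k) `|g (t i) - g (s i)|.
  rewrite -big_split /=; apply: ler_sum => i _.
  by rewrite opprD addrACA ler_normD.
lra.
Qed.

Lemma abs_continuous_cst a b (c : R) : abs_continuous a b (fun=> c : R).
Proof.
move=> e e0; exists 1 => // k s t _ _ _.
by rewrite big1 // => i _; rewrite subrr normr0.
Qed.

Lemma abs_continuousM a b f g (M : R) : 0 < M ->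
  (forall t, a <= t <= b -> `|f t| <= M) -> (forall t, a <= t <= b ->
    `|g t| <= M) ->
  abs_continuous a b f -> abs_continuous a b g ->
  abs_continuous a b (fun t => f t * g t).
Proof.
move=> M0 fM gM acf acg e e0; have e20 : 0 < e / (2 * M) by rewrite divr_gt0
  ?mulr_gt0.
have [d1 d10 fd] := acf _ e20; have [d2 d20 gd] := acg _ e20.
exists (Num.min d1 d2) => [|k s t ab dis]; first by rewrite lt_min d10.
rewrite lt_min => /andP[sd1 sd2].
have H1 := fd k s t ab dis sd1; have H2 := gd k s t ab dis sd2.
apply: (@le_lt_trans _ _ (M * \sum_(i < k) `|f (t i) - f (s i)| +
    M * \sum_(i < k) `|g (t i) - g (s i)|)).
  rewrite !mulr_sumr -big_split /=; apply: ler_sum => i _.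
  have [h1 [h2 h3]] := ab i.
  rewrite (_ : _ - _ = (f (t i) - f (s i)) * g (t i) + f (s i) * (g (t i) - g
    (s i)));
    last by ring.
  apply: le_trans (ler_normD _ _) _; rewrite !normrM [_ * `|g _|]mulrC.
  by apply: lerD; apply: ler_wpM2r => //; [apply: gM|apply: fM]; lra.
rewrite -mulrDr mulrC -ltr_pdivlMr //.
suff -> : e / M = e / (2 * M) + e / (2 * M) by exact: ltrD.
by field; lra.
Qed.

Lemma ae_solutionD f F g G : ae_solution f g -> ae_solution F G ->
  ae_solution (fun t => f t + F t) (fun t => g t + G t).
Proof.
move=> [acf df] [acF dF]; split.
  by move=> b b0; apply: abs_continuousD; [exact: acf|exact: acF].
by apply: lebesgue_aeS2 df dF => t H1 H2 t0; apply: is_deriveD;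
  [exact: H1|exact: H2].
Qed.

Lemma ae_solution_cst (c : R) : ae_solution (fun=> c : R) (fun=> 0).
Proof.
split; first by move=> b _; exact: abs_continuous_cst.
by apply: aeW => t _; exact: is_derive_cst.
Qed.

Lemma ae_solutionM f F g G : ae_solution f g -> ae_solution F G ->
  ae_solution (fun t => f t * F t) (fun t => g t * F t + f t * G t).
Proof.
move=> sf sF; have cf := ae_solution_continuous sf.
have cF := ae_solution_continuous sF.
have [acf df] := sf; have [acF dF] := sF; split.
  move=> b b0.
  have [M1 M10 fM] := halfline_continuous_bounded cf (ltW b0).
  have [M2 M20 FM] := halfline_continuous_bounded cF (ltW b0).
  apply: (@abs_continuousM _ _ _ _ (Num.max M1 M2)) => //.
  - by rewrite lt_max M10.
  - by move=> t tb; rewrite le_max fM.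
  - by move=> t tb; rewrite le_max FM ?orbT.
  - exact: acf.
  - exact: acF.
apply: lebesgue_aeS2 df dF => t H1 H2 t0; apply: is_derive_eq.
  by apply: is_deriveM; [exact: H1|exact: H2].
by rewrite /GRing.scale /= addrC; congr (_ + _); rewrite mulrC.
Qed.

Lemma ae_solutionZ (c : R) f g : ae_solution f g ->
  ae_solution (fun t => c * f t) (fun t => c * g t).
Proof.
move=> sf; apply: eq_ae_solution (ae_solutionM (ae_solution_cst c) sf) => //= t _.
by rewrite mul0r add0r.
Qed.

Lemma ae_solutionB f F g G : ae_solution f g -> ae_solution F G ->
  ae_solution (fun t => f t - F t) (fun t => g t - G t).
Proof.
move=> sf /(ae_solutionZ (-1)) /(ae_solutionD sf); apply: eq_ae_solution => //.
  by move=> t _; rewrite mulN1r.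
by apply/funext => t; rewrite mulN1r.
Qed.

Lemma ae_solution_sum (I : Type) (r : seq I) (f g : I -> R -> R) :
  (forall i, ae_solution (f i) (g i)) ->
  ae_solution (fun t => \sum_(i <- r) f i t) (fun t => \sum_(i <- r) g i t).
Proof.
move=> s; elim: r => [|i r IH].
  apply: eq_ae_solution (ae_solution_cst 0) => [t _|]; first by rewrite big_nil.
  by apply/funext => t; rewrite big_nil.
apply: eq_ae_solution (ae_solutionD (s i) IH) => [t _|]; first by rewrite big_cons.
by apply/funext => t; rewrite big_cons.
Qed.

Lemma abs_continuousW a b c d f : a <= c -> d <= b -> abs_continuous a b f ->
  abs_continuous c d f.
Proof.
move=> ac db acf e e0; have [r r0 rP] := acf e e0; exists r => // k s t st.
by apply: rP => i; have [? [? ?]] := st i; split; [|split]; lra.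
Qed.

Lemma ae_solution_le f F g G a b : ae_solution f g -> ae_solution F G ->
  0 <= a -> a <= b -> (forall t, a <= t <= b -> g t <= G t) ->
  f b - f a <= F b - F a.
Proof.
move=> sf sF a0 ab gG.
have [ach dh] := ae_solutionB sf sF.
suff : f b - F b <= f a - F a by lra.
apply: (@abs_continuous_nonincreasing _ a b (fun t => f t - F t) (fun t =>
  g t - G t)) => //.
  (* Absolute continuity is given on [[0, c]] for [c > 0] only, and [b] may be 0. *)
  apply: (@abs_continuousW 0 (b + 1)) => //; first lra.
  by apply: ach; lra.
apply: lebesgue_aeS dh => t H tab; split; last by rewrite subr_le0 gG.
by apply: H; have /andP[? _] := tab; exact: le_trans a0 _.
Qed.

Lemma ae_solution_id : ae_solution (@id R) (fun=> 1).
Proof.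
split; last by apply: aeW => t _; exact: is_derive_id.
move=> b _ e e0; exists e => // k s t st _ le; apply: le_lt_trans le.
apply: ler_sum => i _; rewrite ger0_norm // subr_ge0.
by have [? []] := st i.
Qed.

(** Suppose [f] exceeds [c] at [t], and take the last earlier time with [f <= c]. There [f] equals
    [c] by continuity, and from there to [t] it stays above [c], hence does not increase: a
    contradiction. *)
Lemma ae_solution_barrier f g a (c : R) : ae_solution f g -> 0 <= a -> f a <= c ->
  (forall t, a <= t -> c <= f t -> g t <= 0) -> forall t, a <= t -> f t <= c.
Proof.
move=> sf a0 fa gc t at_; rewrite leNgt; apply/negP => cft.
have cf := ae_solution_continuous sf.
have cw : {within `[a, t], continuous f} by exact: halfline_continuous_within.
have mono s : a <= s -> s <= t -> (forall r, s < r <= t -> c <= f r) ->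
  c <= f s -> f t <= f s.
  move=> as_ st H cs.
  have := ae_solution_le sf (ae_solution_cst 0) (le_trans a0 as_) st.
  rewrite subrr subr_le0; apply => r /andP[sr rt]; apply: gc; first lra.
  by move: sr; rewrite le_eqVlt => /orP[/eqP<-//|sr]; apply: H; rewrite sr.
pose S := [set s | a <= s <= t /\ f s <= c].
have supS : has_sup S.
  by split; [exists a; split => //; rewrite lexx|exists t => s [/andP[]]].
pose s := sup S.
have as_ : a <= s by apply: (ub_le_sup supS.2); split; rewrite ?lexx.
have st : s <= t by apply: ge_sup; [exact: supS.1|move=> r [/andP[]]].
have above r : s < r <= t -> c < f r.
  move=> /andP[sr rt]; rewrite ltNge; apply/negP => fr.
  have : r <= s by apply: (ub_le_sup supS.2); split => //; rewrite rt andbT; lra.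
  lra.
have fs : f s = c.
  apply/le_anti; apply/andP; split.
    rewrite leNgt; apply/negP => cs.
    have : \forall x \near s, c < f (Num.max 0 x).
      by apply: cvgr_gt (cf s) _ _; rewrite max_r //; lra.
    move=> /nbhs_ballP [d /= d0 dP].
    have [x [/andP[ax xt] fx] xs] := sup_adherent d0 supS.
    have xs' : x <= s by apply: (ub_le_sup supS.2); split => //; apply/andP.
    have := dP x; rewrite /ball /= max_r; last lra.
    rewrite ger0_norm; last lra.
    by move=> /(_ _); rewrite -/s in xs; move=> H; have := H ltac:(lra); lra.
  rewrite leNgt; apply/negP => cs.
  have st' : s < t by rewrite lt_neqAle st andbT; apply/eqP => E;
    rewrite E in cs; lra.
  have : \forall x \near s, f (Num.max 0 x) < c.
    by apply: cvgr_lt (cf s) _ _; rewrite max_r //; lra.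
  move=> /nbhs_ballP [d /= d0 dP].
  pose x := Num.min t (s + d / 2).
  have sx : s < x by rewrite lt_min st' /=; lra.
  have xt : x <= t by rewrite ge_min lexx.
  have xd : x <= s + d / 2 by rewrite ge_min lexx orbT.
  have := above x; rewrite sx xt => /(_ isT).
  have := dP x; rewrite /ball /= max_r; last lra.
  rewrite distrC ger0_norm; last lra.
  by move=> H; have := H ltac:(lra); lra.
have : f t <= f s.
  by apply: mono => //; [move=> r /above/ltW|rewrite fs].
lra.
Qed.

End absolutely_continuous_solutions.

(** * Antiderivatives of continuous signals and decay *)

Section antiderivatives.
Context {R : realType}.
Implicit Types f g H : R -> R.

Lemma lipschitz_abs_continuous a b (M : R) f : 0 < M ->
  (forall s t, a <= s -> s <= t -> t <= b -> `|f t - f s| <= M * (t - s)) ->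
  abs_continuous a b f.
Proof.
move=> M0 fM e e0; exists (e / M) => [|k s t st _]; first by rewrite divr_gt0.
rewrite ltr_pdivlMr // mulrC => lt_e; apply: le_lt_trans lt_e.
by rewrite mulr_sumr; apply: ler_sum => i _; have [? []] := st i; exact: fM.
Qed.

Lemma halfline_antiderivative f : halfline_continuous f ->
  exists H, ae_solution H f /\ forall a b, 0 <= a -> a <= b ->
    \int[@lebesgue_measure R]_(t in `[a, b]) f t = H b - H a.
Proof.
move=> cf; pose F (t : R) : R := f (Num.max 0 t).
have FE (t : R) : 0 <= t -> F t = f t by move=> t0; rewrite /F max_r.
(* Integrating the extended signal from -1 makes 0 an interior point, where [H] then has a two-sided
   derivative. *)
pose H (x : R) : R := \int[@lebesgue_measure R]_(t in `[-1, x]) F t.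
have dH (x : R) : -1 < x -> is_derive x 1 H (F x).
  move=> x1.
  have xu : x < x + 1 by rewrite ltrDl.
  have iF : (@lebesgue_measure R).-integrable `[-1, x + 1] (EFin \o F).
    apply: continuous_compact_integrable; first exact: segment_compact.
    exact: continuous_subspaceT.
  have [dx Hx] := continuous_FTC1_closed xu iF x1 (cf x).
  exact: (DeriveDef dx (etrans (esym (derive1E _ _)) Hx)).
have cH (a b : R) : -1 < a -> {within `[a, b], continuous H}.
  move=> a1; apply: derivable_within_continuous => x;
    rewrite in_itv /= => /andP[ax _].
  by have [] := dH x (lt_le_trans a1 ax).
exists H; split.
  split; last first.
    apply: aeW => t t0; rewrite -FE //; apply: dH; lra.
  move=> b b0.
  have [M M0 fM] := halfline_continuous_bounded cf (ltW b0).
  apply: lipschitz_abs_continuous M0 _ => s t s0 st tb.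
  have [||c + ->] := @MVT_segment _ H F s t st.
  - by move=> x; rewrite in_itv /= => /andP[sx _]; apply: dH; lra.
  - by apply: cH; lra.
  - rewrite in_itv /= => /andP[sc ct].
    rewrite normrM [`|t - s|]ger0_norm ?subr_ge0 //; apply: ler_wpM2r;
      rewrite ?subr_ge0 //.
    by rewrite FE; [apply: fM|]; lra.
move=> a b a0 ab.
transitivity (\int[@lebesgue_measure R]_(t in `[a, b]) F t).
  apply: eq_Rintegral => x; rewrite inE /= in_itv /= => /andP[ax _].
  by rewrite FE //; lra.
move: ab; rewrite le_eqVlt => /orP[/eqP <-|ab].
  by rewrite set_itv1 Rintegral_set1 subrr.
rewrite /Rintegral (@continuous_FTC2 _ F H a b) //.
- exact: continuous_subspaceT.
- split.
  + by move=> x; rewrite in_itv /= => /andP[ax _]; have [] := dH x ltac:(lra).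
  + have [dHa _] := dH a ltac:(lra).
    by apply: cvg_at_right_filter; apply/differentiable_continuous/derivable1_diffP.
  + have [dHb _] := dH b ltac:(lra).
    by apply: cvg_at_left_filter; apply/differentiable_continuous/derivable1_diffP.
- move=> x; rewrite in_itv /= => /andP[ax _]; rewrite derive1E.
  by have [_ ->] := dH x ltac:(lra).
Qed.

(** Once [q <= s * e / 2], [V] falls at least at the rate [s * e / 2] as long as it is above [e]. So
    it comes below [e] in finite time, and the barrier keeps it there. *)
Lemma ae_solution_decay (V v q : R -> R) (s : R) : ae_solution V v ->
  (forall t, 0 <= t -> 0 <= V t) -> 0 < s -> q t @[t --> +oo] --> (0 : R) ->
  (forall t, 0 <= t -> v t <= - s * V t + q t) -> V t @[t --> +oo] --> (0 : R).
Proof.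
move=> sV V0 s0 q0 vV; apply/cvgrPdist_le => /= e e0.
have se0 : 0 < s * e / 2 by rewrite divr_gt0 ?mulr_gt0.
have [T [T0 qT]] : exists T, 0 <= T /\ forall t, T <= t -> q t <= s * e / 2.
  have /cvgrPdist_le /(_ _ se0) [M [_ MP]] := q0.
  exists (Num.max 0 (M + 1)); split=> [|t]; first by rewrite le_max lexx.
  rewrite ge_max => /andP[_ Mt]; have := MP t ltac:(lra).
  by rewrite /= sub0r normrN => /(le_trans (ler_norm _)).
have drop t : T <= t -> e <= V t -> v t <= - (s * e / 2).
  move=> Tt eV; apply: le_trans (vV _ _) _; first lra.
  have := qT t Tt; have : s * e <= s * V t by rewrite ler_pM2l.
  lra.
have [t1 [Tt1 Vt1]] : exists t1, T <= t1 /\ V t1 <= e.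
  apply: contrapT => nV.
  have VT : 0 <= V T by exact: V0.
  (* After this time a fall at the rate [s * e / 2] would have made [V] negative. *)
  pose X := V T / (s * e / 2) + 1.
  have X0 : 0 <= X by rewrite addr_ge0 // divr_ge0 // ltW.
  have := ae_solution_le sV (ae_solutionZ (- (s * e / 2)) ae_solution_id) T0 _ _.
  move=> /(_ (T + X)); rewrite lerDl X0 => /(_ isT) H.
  have {H}: V (T + X) - V T <= - (s * e / 2) * (T + X) - - (s * e / 2) * T.
    apply: H => t /andP[Tt _]; rewrite mulr1; apply: drop => //.
    by rewrite leNgt; apply/negP => Vt; apply: nV; exists t; split=> //; exact: ltW.
  have : 0 <= V (T + X) by apply: V0; lra.
  have : (s * e / 2) * X = V T + s * e / 2.
    by rewrite /X mulrDr mulr1 mulrC divfK // gt_eqF.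
  lra.
exists t1; split; first exact: num_real.
move=> t t1t; rewrite sub0r normrN ger0_norm; last by apply: V0; lra.
apply: (ae_solution_barrier sV _ Vt1) (ltW t1t); first lra.
by move=> r tr /drop H; apply: le_trans (H _) _; lra.
Qed.

End antiderivatives.

(** * Vector signals and entrywise convergence *)

Section vector_signals.
Context {R : realType}.

Definition vec_solution n (x g : R -> 'cV[R]_n) : Prop :=
  forall i, ae_solution (fun t => x t i 0) (fun t => g t i 0).

Lemma mx_entry_le_norm m n (M : 'M[R]_(m, n)) i j : `|M i j| <= `|M|.
Proof. by rewrite [leRHS]mx_normrE; exact: (le_bigmax _ _ (i, j)). Qed.

Lemma ae_solution_entry n (x g : R -> 'cV[R]_n) :
  ae_solution x g -> vec_solution x g.
Proof.
move=> [acx dx] i; split.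
  move=> b b0 e e0; have [d d0 dP] := acx b b0 e e0;
    exists d => // k s t st dis lt_d.
  apply: le_lt_trans (dP k s t st dis lt_d); apply: ler_sum => j _.
  by apply: le_trans (mx_entry_le_norm _ i 0); rewrite !mxE.
apply: lebesgue_aeS dx => t H t0; have [dxt <-] := H t0.
rewrite derive_mx // mxE; apply: DeriveDef => //.
exact: (proj1 (derivable_mxP _ _ _) dxt).
Qed.

Lemma vec_solutionD n (x g y h : R -> 'cV[R]_n) :
  vec_solution x g -> vec_solution y h ->
  vec_solution (fun t => x t + y t) (fun t => g t + h t).
Proof.
move=> sx sy i; apply: eq_ae_solution (ae_solutionD (sx i) (sy i)) => [t _|].
  by rewrite mxE.
by apply/funext => t; rewrite mxE.
Qed.

Lemma vec_solution_mulmx m n (M : 'M[R]_(m, n)) (x g : R -> 'cV[R]_n) :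
  vec_solution x g -> vec_solution (fun t => M *m x t) (fun t => M *m g t).
Proof.
move=> sx i.
apply: eq_ae_solution (ae_solution_sum (index_enum 'I_n) (fun j =>
  ae_solutionZ (M i j) (sx j))) => [t _|].
  by rewrite mxE.
by apply/funext => t; rewrite mxE.
Qed.

Lemma vec_solutionZ n (c : R) (x g : R -> 'cV[R]_n) :
  vec_solution x g -> vec_solution (fun t => c *: x t) (fun t => c *: g t).
Proof.
move=> sx i; apply: eq_ae_solution (ae_solutionZ c (sx i)) => [t _|].
  by rewrite mxE.
by apply/funext => t; rewrite mxE.
Qed.

Lemma eq_vec_solution n (x g h : R -> 'cV[R]_n) : (forall t, 0 <= t -> g t = h t) ->
  vec_solution x g -> vec_solution x h.
Proof.
by move=> gh sx i; apply: eq_ae_solution (sx i) => // t t0; rewrite gh.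
Qed.

Lemma vec_solutionBc n (x g : R -> 'cV[R]_n) (c : 'cV[R]_n) :
  vec_solution x g -> vec_solution (fun t => x t - c) g.
Proof.
move=> sx i; apply: eq_ae_solution (ae_solutionB (sx i) (ae_solution_cst (c i
  0))) => [t _|].
  by rewrite subr0.
by apply/funext => t; rewrite !mxE.
Qed.

Lemma vec_solution_continuous n (x g : R -> 'cV[R]_n) i :
  vec_solution x g -> halfline_continuous (fun t => x t i 0).
Proof. by move=> sx; exact: ae_solution_continuous (sx i). Qed.

End vector_signals.

Section entrywise_convergence.
Context {R : realType} {T : Type} {F : set_system T} {FF : Filter F}.

(** Entrywise, so that products, determinants and inverses reduce to limits of real functions. *)
Record mx_cvg m n (M : T -> 'M[R]_(m, n)) (M0 : 'M[R]_(m, n)) : Prop := MxCvg {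
  mx_cvgE : forall i j, M t i j @[t --> F] --> M0 i j }.
Arguments mx_cvgE {m n M M0} _ i j _ _.

Lemma mx_cvgP m n (M : T -> 'M[R]_(m, n)) (M0 : 'M[R]_(m, n)) :
  mx_cvg M M0 -> M t @[t --> F] --> M0.
Proof.
move=> MM0; apply/cvgrPdist_le => /= e e0.
have : \forall t \near F, forall ij : 'I_m * 'I_n,
  `|M0 ij.1 ij.2 - M t ij.1 ij.2| <= e.
  by apply: filter_forall => ij; have /cvgrPdist_le := mx_cvgE MM0 ij.1 ij.2; exact.
apply: filterS => t Ht; rewrite /Num.norm /= mx_normrE.
by apply: (bigmax_le _ (ltW e0)) => ij _; rewrite !mxE.
Qed.

Lemma mx_cvg_cst m n (M0 : 'M[R]_(m, n)) : mx_cvg (fun=> M0) M0.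
Proof. by split=> i j; exact: cvg_cst. Qed.

Lemma mx_cvgD m n (M N : T -> 'M[R]_(m, n)) M0 N0 : mx_cvg M M0 -> mx_cvg N N0 ->
  mx_cvg (fun t => M t + N t) (M0 + N0).
Proof.
move=> cM cN; split=> i j; rewrite mxE.
rewrite (_ : (fun t => _) = (fun t => M t i j + N t i j)).
  by apply: cvgD; [exact: mx_cvgE|exact: mx_cvgE].
by apply/funext => t; rewrite mxE.
Qed.

Lemma mx_cvgZ m n (c : R) (M : T -> 'M[R]_(m, n)) M0 : mx_cvg M M0 ->
  mx_cvg (fun t => c *: M t) (c *: M0).
Proof.
move=> cM; split=> i j; rewrite mxE.
rewrite (_ : (fun t => _) = (fun t => c * M t i j)).
  by apply: cvgM; [exact: cvg_cst|exact: mx_cvgE].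
by apply/funext => t; rewrite mxE.
Qed.

Lemma mx_cvgB m n (M N : T -> 'M[R]_(m, n)) M0 N0 : mx_cvg M M0 -> mx_cvg N N0 ->
  mx_cvg (fun t => M t - N t) (M0 - N0).
Proof.
move=> cM cN; have := mx_cvgD cM (mx_cvgZ (-1) cN); rewrite scaleN1r.
by under [X in mx_cvg X _ -> _]eq_fun do rewrite scaleN1r.
Qed.

Lemma cvg_big_sum (I : Type) (r : seq I) (f : I -> T -> R) (l : I -> R) :
  (forall i, f i t @[t --> F] --> l i) ->
  \sum_(i <- r) f i t @[t --> F] --> \sum_(i <- r) l i.
Proof.
move=> fl; elim: r => [|i r IH].
  rewrite big_nil (_ : (fun t => _) = (fun=> 0)); first exact: cvg_cst.
  by apply/funext => t; rewrite big_nil.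
rewrite big_cons (_ : (fun t => _) = (fun t => f i t + \sum_(j <- r) f j t)).
  by apply: cvgD.
by apply/funext => t; rewrite big_cons.
Qed.

Lemma cvg_big_prod (I : Type) (r : seq I) (f : I -> T -> R) (l : I -> R) :
  (forall i, f i t @[t --> F] --> l i) ->
  \prod_(i <- r) f i t @[t --> F] --> \prod_(i <- r) l i.
Proof.
move=> fl; elim: r => [|i r IH].
  rewrite big_nil (_ : (fun t => _) = (fun=> 1)); first exact: cvg_cst.
  by apply/funext => t; rewrite big_nil.
rewrite big_cons (_ : (fun t => _) = (fun t => f i t * \prod_(j <- r) f j t)).
  by apply: cvgM.
by apply/funext => t; rewrite big_cons.
Qed.

Lemma mx_cvgM m n p (M : T -> 'M[R]_(m, n)) (N : T -> 'M[R]_(n, p)) M0 N0 :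
  mx_cvg M M0 -> mx_cvg N N0 -> mx_cvg (fun t => M t *m N t) (M0 *m N0).
Proof.
move=> cM cN; split=> i j; rewrite mxE.
rewrite (_ : (fun t => _) = (fun t => \sum_k M t i k * N t k j)).
  by apply: cvg_big_sum => k; apply: cvgM; [exact: mx_cvgE|exact: mx_cvgE].
by apply/funext => t; rewrite mxE.
Qed.

Lemma mx_cvg_tr m n (M : T -> 'M[R]_(m, n)) M0 :
  mx_cvg M M0 -> mx_cvg (fun t => (M t)^T) M0^T.
Proof.
move=> cM; split=> i j; rewrite mxE (_ : (fun t => _) = (fun t => M t j i));
  first exact: mx_cvgE.
by apply/funext => t; rewrite mxE.
Qed.

Lemma mx_cvg_det n (M : T -> 'M[R]_n) M0 :
  mx_cvg M M0 -> \det (M t) @[t --> F] --> \det M0.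
Proof.
move=> cM; rewrite /determinant; apply: cvg_big_sum => s.
by apply: cvgM; [exact: cvg_cst|apply: cvg_big_prod => i; exact: mx_cvgE].
Qed.

(** By the adjugate formula every entry is a cofactor divided by the determinant. On singular
    matrices [invmx] is the identity instead, hence the condition of eventual invertibility. *)
Lemma mx_cvg_inv n (M : T -> 'M[R]_n) M0 : M0 \in unitmx ->
  F [set t | M t \in unitmx] ->
  mx_cvg M M0 -> mx_cvg (fun t => invmx (M t)) (invmx M0).
Proof.
move=> uM0 uM cM; split=> i j.
have cf : (\det (M t))^-1 * (\adj (M t) i j) @[t --> F] --> invmx M0 i j.
  rewrite /invmx uM0 mxE; apply: cvgM.
    by apply: cvgV; [rewrite -unitfE -unitmxE|exact: mx_cvg_det].
  rewrite mxE (_ : (fun t => _) = (fun t => cofactor (M t) j i)); last first.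
    by apply/funext => t; rewrite mxE.
  rewrite /cofactor; apply: cvgM; first exact: cvg_cst.
  apply: mx_cvg_det; split=> a b; rewrite !mxE.
  by under eq_fun do rewrite !mxE; exact: mx_cvgE.
apply: cvg_trans cf.
apply: (@near_eq_cvg _ _ F FF); apply: filterS uM => t uMt.
rewrite /= in uMt *; by rewrite /invmx uMt !mxE.
Qed.

End entrywise_convergence.

Arguments mx_cvgE {R T F m n M M0} _ i j _ _.

(** * Linear systems with Hurwitz matrix *)

Section hurwitz_decay.
Context {R : realType}.
Local Notation C := R[i].
Local Notation Cmx := (map_mx (real_complex R)).
Local Notation rmx := (map_mx (@complex.Re R)).
Local Notation imx := (map_mx (@complex.Im R)).

Lemma Re_mulmxr m n p (M : 'M[C]_(m, n)) (A : 'M[R]_(n, p)) :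
  rmx (M *m Cmx A) = rmx M *m A.
Proof.
apply/matrixP => i j; rewrite !mxE (big_morph (@complex.Re R) (id1 :=
  0) (op1 := +%R)) //.
  by apply: eq_bigr => k _; rewrite !mxE; case: (M i k) => a b /=;
    rewrite mulr0 subr0.
by move=> [a b] [c d].
Qed.

Lemma Im_mulmxr m n p (M : 'M[C]_(m, n)) (A : 'M[R]_(n, p)) :
  imx (M *m Cmx A) = imx M *m A.
Proof.
apply/matrixP => i j; rewrite !mxE (big_morph (@complex.Im R) (id1 :=
  0) (op1 := +%R)) //.
  by apply: eq_bigr => k _; rewrite !mxE; case: (M i k) => a b /=;
    rewrite mulr0 add0r.
by move=> [a b] [c d].
Qed.

Lemma cvg0_sqr_le (f V : R -> R) : V t @[t --> +oo] --> (0 : R) ->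
  (forall t, 0 <= t -> f t ^+ 2 <= V t) -> f t @[t --> +oo] --> (0 : R).
Proof.
move=> V0 fV; apply/cvgrPdist_le => /= e e0.
have e20 : 0 < e ^+ 2 by rewrite exprn_gt0.
have /cvgrPdist_le /(_ _ e20) H := V0.
near=> t; rewrite sub0r normrN.
rewrite -(@ler_pXn2r _ 2) ?nnegrE //; last exact: ltW.
rewrite real_normK ?num_real //.
apply: le_trans (fV _ _) _.
  by near: t; exact: nbhs_pinfty_ge.
have : `|0 - V t| <= e ^+ 2 by near: t.
by rewrite sub0r normrN; exact: le_trans (ler_norm _).
Unshelve. all: by end_near. Qed.

(* One eigenvalue at a time: if [M] commutes with [A], then [y := M *m e]
   satisfies [y' = l y + (A - l) M e + M p]. *)
Lemma eigenvalue_decay_step n (A : 'M[R]_n) (e p : R ->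
  'cV[R]_n) (M : 'M[C]_n) (l : C) :
  vec_solution e (fun t => A *m e t + p t) -> mx_cvg (F := +oo) p 0 ->
  Cmx A *m M = M *m Cmx A -> complex.Re l < 0 ->
  mx_cvg (F := +oo) (fun t => rmx (Cmx A *m M - l *: M) *m e t) 0 ->
  mx_cvg (F := +oo) (fun t => imx (Cmx A *m M - l *: M) *m e t) 0 ->
  mx_cvg (F := +oo) (fun t => rmx M *m e t) 0 /\
  mx_cvg (F := +oo) (fun t => imx M *m e t) 0.
Proof.
move=> se p0 cAM l0 cN1 cN2.
set N := Cmx A *m M - l *: M in cN1 cN2.
pose lr := complex.Re l; pose li := complex.Im l.
(* As [e] is real, [M *m e] splits into the real signals [rmx M *m e] and [imx M *m e]; these are
   the two parts of [M A = N + l M]. *)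
have NR : rmx M *m A = rmx N + lr *: rmx M - li *: imx M.
  rewrite -Re_mulmxr -cAM; apply/matrixP => i j; rewrite !mxE.
  rewrite /lr /li; move: (\sum_ _ _) (M i j) (l) => [a b] [c d] [x y] /=; ring.
have NI : imx M *m A = imx N + lr *: imx M + li *: rmx M.
  rewrite -Im_mulmxr -cAM; apply/matrixP => i j; rewrite !mxE.
  rewrite /lr /li; move: (\sum_ _ _) (M i j) (l) => [a b] [c d] [x y] /=; ring.
pose q1 i t := (rmx N *m e t) i 0 + (rmx M *m p t) i 0.
pose q2 i t := (imx N *m e t) i 0 + (imx M *m p t) i 0.
have cq1 i : q1 i t @[t --> +oo] --> (0 : R).
  rewrite -[0]addr0; apply: cvgD; first by have := mx_cvgE cN1 i 0; rewrite mxE.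
  have H : mx_cvg (F := +oo) (fun t => rmx M *m p t) (rmx M *m 0).
    by apply: mx_cvgM => //; exact: mx_cvg_cst.
  by have := mx_cvgE H i 0; rewrite mulmx0 mxE.
have cq2 i : q2 i t @[t --> +oo] --> (0 : R).
  rewrite -[0]addr0; apply: cvgD; first by have := mx_cvgE cN2 i 0; rewrite mxE.
  have H : mx_cvg (F := +oo) (fun t => imx M *m p t) (imx M *m 0).
    by apply: mx_cvgM => //; exact: mx_cvg_cst.
  by have := mx_cvgE H i 0; rewrite mulmx0 mxE.
pose a i t := (rmx M *m e t) i 0; pose b i t := (imx M *m e t) i 0.
have sa i : ae_solution (a i) (fun t => lr * a i t - li * b i t + q1 i t).
  apply: eq_ae_solution (vec_solution_mulmx (rmx M) se i) => // t _.
  rewrite mulmxDr mulmxA NR !mulmxDl mulNmx -!scalemxAl /a /b /q1.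
  move: (rmx N *m _) (rmx M *m e t) (imx M *m _) (rmx M *m p t) => u v w x.
  rewrite !mxE; ring.
have sb i : ae_solution (b i) (fun t => lr * b i t + li * a i t + q2 i t).
  apply: eq_ae_solution (vec_solution_mulmx (imx M) se i) => // t _.
  rewrite mulmxDr mulmxA NI !mulmxDl -!scalemxAl /a /b /q2.
  move: (imx N *m _) (rmx M *m e t) (imx M *m e t) (imx M *m p t) => u v w x.
  rewrite !mxE; ring.
(* In the derivative of this squared modulus the rotation by [li] cancels, leaving [2 * lr * V] and
   the cross terms [2 * (a * q1 + b * q2)]. Young's inequality spends half of the decay on the
   latter, hence the rate [- lr]. *)
pose V i t := a i t * a i t + b i t * b i t.
have cV i : V i t @[t --> +oo] --> (0 : R).
  have := ae_solutionD (ae_solutionM (sa i) (sa i)) (ae_solutionM (sb i) (sb i)).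
  rewrite -/(V i) => sV.
  apply: (ae_solution_decay (s := - lr) (q := fun t =>
    (q1 i t * q1 i t + q2 i t * q2 i t) / - lr) sV).
  - by move=> t _; rewrite addr_ge0 // -expr2 sqr_ge0.
  - by rewrite oppr_gt0.
  - have H : (q1 i t * q1 i t + q2 i t * q2 i t) / - lr @[t --> +oo] -->
        (0 * 0 + 0 * 0) / - lr.
      by apply: cvgM; [apply: cvgD; apply: cvgM|exact: cvg_cst].
    by rewrite mul0r addr0 mul0r in H.
  move=> t _; rewrite /V.
  have amgm x y : 2 * x * y <= - lr * (x * x) + (y * y) / - lr.
    have lr0 : 0 < - lr by rewrite oppr_gt0.
    rewrite -subr_ge0.
    have -> : - lr * (x * x) + y * y / - lr - 2 * x * y = (lr * x + y) ^+ 2 / - lr.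
      by field; rewrite lt_eqF.
    by rewrite divr_ge0 ?sqr_ge0 // ltW.
  have := amgm (a i t) (q1 i t); have := amgm (b i t) (q2 i t).
  rewrite mulrDl; lra.
split; split=> i j; rewrite (ord1 j) mxE; apply: (cvg0_sqr_le (cV i)) => t _.
  by rewrite -/(a i t) expr2 lerDl -expr2 sqr_ge0.
by rewrite -/(b i t) expr2 lerDr -expr2 sqr_ge0.
Qed.

(* By Cayley-Hamilton the product of all the [A - l], over the eigenvalues [l],
   is zero; the factors are then removed one by one. *)
Lemma hurwitz_decay n (A : 'M[R]_n) (e p : R -> 'cV[R]_n) : hurwitz A ->
  vec_solution e (fun t => A *m e t + p t) -> mx_cvg (F := +oo) p 0 ->
  mx_cvg (F := +oo) e 0.
Proof.
(* Evaluating a polynomial at a matrix needs a positive size; in dimension 0 there is no entry to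
   check. *)
case: n => [|n] in A e p *; first by move=> _ _ _; split=> -[].
move=> hA se p0.
pose Q (M : 'M[C]_n.+1) := mx_cvg (F := +oo) (fun t => rmx M *m e t) 0 /\
  mx_cvg (F := +oo) (fun t => imx M *m e t) 0.
have [r chE] := closed_field_poly_normal (char_poly (Cmx A)).
rewrite (monicP (char_poly_monic _)) scale1r in chE.
have r0 l : l \in r -> complex.Re l < 0.
  move=> lr; apply: hA; rewrite eigenvalue_root_char chE.
  by rewrite root_prod_XsubC.
have Q0 : Q (horner_mx (Cmx A) (\prod_(z <- r) ('X - z%:P))).
  rewrite -chE Cayley_Hamilton; split.
    rewrite (_ : rmx 0 = 0); last by apply/matrixP => i j; rewrite !mxE.
    by under eq_fun do rewrite mul0mx; exact: mx_cvg_cst.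
  rewrite (_ : imx 0 = 0); last by apply/matrixP => i j; rewrite !mxE.
  by under eq_fun do rewrite mul0mx; exact: mx_cvg_cst.
have : Q 1%:M.
  elim: r r0 Q0 {chE} => [|z r IH] r0; first by rewrite big_nil rmorph1.
  rewrite big_cons rmorphM rmorphB /= horner_mx_X horner_mx_C => -[Q1 Q2].
  apply: IH => [l lr|]; first by apply: r0; rewrite inE lr orbT.
  have E : (Cmx A - z%:M) * horner_mx (Cmx A) (\prod_(z <- r) ('X - z%:P)) =
    Cmx A *m horner_mx (Cmx A) (\prod_(z <- r) ('X - z%:P)) -
     z *: horner_mx (Cmx A) (\prod_(z <- r) ('X - z%:P)).
    by rewrite mulrBl -[X in _ - X = _]/(_ *m _) mul_scalar_mx.
  rewrite E in Q1 Q2.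
  apply: (eigenvalue_decay_step se p0 _ _ Q1 Q2); last by apply: r0;
    rewrite mem_head.
  exact: comm_mx_horner.
move=> [+ _].
rewrite (_ : rmx 1%:M = 1%:M); last first.
  by apply/matrixP => i j; rewrite !mxE; case: (i == j).
by under [X in mx_cvg X]eq_fun do rewrite mul1mx.
Qed.

End hurwitz_decay.

(** * Gradient projection *)

Section quadratic_forms.
Context {R : realType}.

Lemma mx_norm_le m n (M : 'M[R]_(m, n)) (e : R) : 0 <= e ->
  (forall i j, `|M i j| <= e) -> `|M| <= e.
Proof.
by move=> e0 Me; rewrite /Num.norm /= mx_normrE; apply: (bigmax_le _ e0) => ij _.
Qed.

Lemma mx_norm_tr m n (M : 'M[R]_(m, n)) : `|M^T| = `|M|.
Proof.
have le_tr p q (N : 'M[R]_(p, q)) : `|N^T| <= `|N|.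
  by apply: mx_norm_le => // i j; rewrite mxE; exact: mx_entry_le_norm.
apply/le_anti/andP; split; first exact: le_tr.
by have := le_tr _ _ M^T; rewrite trmxK.
Qed.

Lemma mx_cvg_id m n (M : 'M[R]_(m, n)) : mx_cvg (F := nbhs M) id M.
Proof. by split=> i j; exact: coord_continuous. Qed.

Lemma trmx_continuous m n : continuous (@trmx R m n).
Proof. by move=> M; exact: (mx_cvgP (mx_cvg_tr (mx_cvg_id M))). Qed.

Lemma qform_continuous n (M : 'M[R]_n) : continuous (qform M).
Proof.
move=> v; have H : mx_cvg (F := nbhs v) (fun x => x^T *m M *m x) (v^T *m M *m v).
  apply: mx_cvgM (mx_cvg_id v); apply: mx_cvgM (mx_cvg_tr (mx_cvg_id v)) _.
  exact: mx_cvg_cst.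
exact: mx_cvgE H 0 0.
Qed.

Lemma qformZ n (M : 'M[R]_n) (a : R) v : qform M (a *: v) = a ^+ 2 * qform M v.
Proof.
rewrite /qform; have -> : (a *: v)^T = a *: v^T by apply/matrixP => i j;
  rewrite !mxE.
by rewrite -!scalemxAl -scalemxAr scalerA mxE expr2.
Qed.

Lemma qformN n (M : 'M[R]_n) v : qform M (- v) = qform M v.
Proof. by rewrite -scaleN1r qformZ sqrrN expr1n mul1r. Qed.

Lemma qform0 n (M : 'M[R]_n) : qform M 0 = 0.
Proof. by rewrite /qform mulmx0 mxE. Qed.

Lemma qform_ge0 n (M : 'M[R]_n) v : (forall v, v != 0 -> 0 < qform M v) ->
  0 <= qform M v.
Proof. by move=> M0; have [->|/M0/ltW//] := eqVneq v 0; rewrite qform0. Qed.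

Lemma mulmx11_sym n (M : 'M[R]_n) (x y : 'cV[R]_n) : M^T = M ->
  (x^T *m M *m y) 0 0 = (y^T *m M *m x) 0 0.
Proof.
move=> Ms; transitivity ((x^T *m M *m y)^T 0 0); first by rewrite [RHS]mxE.
by rewrite !trmx_mul trmxK Ms mulmxA.
Qed.

Lemma qformB_expand n (M : 'M[R]_n) (x y : 'cV[R]_n) (h : R) : M^T = M ->
  qform M (x - h *: y) = qform M x - 2 * h * (y^T *m M *m x) 0 0 + h ^+ 2 *
    qform M y.
Proof.
move=> Ms; rewrite /qform.
have -> : (x - h *: y)^T = x^T - h *: y^T by apply/matrixP => i j; rewrite !mxE.
rewrite !mulmxBl !mulmxBr -!scalemxAl -!scalemxAr.
have := mulmx11_sym x y Ms.
move: (x^T *m M *m x) (x^T *m M *m y) (y^T *m M *m x) (y^T *m M *m y) => a b c d bc.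
by rewrite !mxE bc; ring.
Qed.

(** The constant is the minimum of the form on the unit sphere of the max-norm, extended by
    homogeneity. *)
Lemma qform_coercive n (M : 'M[R]_n) : (forall v, v != 0 -> 0 < qform M v) ->
  exists2 c, 0 < c & forall v, c * `|v| ^+ 2 <= qform M v.
Proof.
move=> M0; pose S := [set u : 'rV[R]_n | `|u| = 1].
have [S0|S0] := pselect (S !=set0); last first.
  (* The sphere is empty only for [n = 0], where every vector is zero. *)
  exists 1 => // v; have [->|v0] := eqVneq v 0;
    first by rewrite normr0 qform0 expr0n mulr0.
  exfalso; apply: S0; exists (`|v|^-1 *: v^T).
  by rewrite /S /= normrZ mx_norm_tr ger0_norm // mulVf // normr_eq0.
have cS : compact S.
  apply: bounded_closed_compact.
    by exists 1; split; [exact: num_real|move=> x x1 u /= ->; exact: ltW].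
  rewrite (_ : S = (fun u : 'rV[R]_n => `|u|) @^-1` [set 1]) //.
  by apply: closed_comp => [u _|]; [exact: norm_continuous|exact: closed_eq].
have cf : {within S, continuous (fun u : 'rV[R]_n => qform M u^T)}.
  apply: continuous_subspaceT => u; apply: continuous_comp;
    last exact: qform_continuous.
  exact: trmx_continuous.
have [u0 u0S u0min] := compact_EVT_min S0 cS cf.
have {}u0S : `|u0| = 1 by rewrite inE in u0S.
exists (qform M u0^T).
  by apply: M0; rewrite -normr_eq0 mx_norm_tr u0S oner_eq0.
move=> v; have [->|v0] := eqVneq v 0; first by rewrite normr0 qform0 expr0n mulr0.
have nv0 : 0 < `|v| by rewrite normr_gt0.
have := u0min (`|v|^-1 *: v^T); rewrite inE /S /= normrZ mx_norm_tr.
rewrite ger0_norm ?invr_ge0 ?(ltW nv0) // mulVf ?gt_eqF // => /(_ erefl).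
rewrite linearZ /= trmxK qformZ exprVn mulrC ler_pdivlMr ?exprn_gt0 //.
Qed.

Lemma qform_minimizer n (M : 'M[R]_n) (K : set 'cV[R]_n) (y q0 : 'cV[R]_n) :
  (forall v, v != 0 -> 0 < qform M v) -> closed K -> K q0 ->
  exists p, K p /\ forall q, K q -> qform M (p - y) <= qform M (q - y).
Proof.
move=> M0 clK Kq0; have [c c0 cM] := qform_coercive M0.
pose f (u : 'rV[R]_n) := qform M (u^T - y).
have ctr : continuous (fun u : 'rV[R]_n => u^T) by exact: trmx_continuous.
have cf : continuous f.
  move=> u; apply: (@continuous_comp _ _ _ (fun u : 'rV[R]_n => u^T - y) (qform M)).
    exact: (cvgB (ctr u) (cvg_cst _)).
  exact: qform_continuous.
pose S := [set u : 'rV[R]_n | K u^T /\ f u <= f q0^T].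
have Sq0 : S q0^T by split => //; rewrite trmxK.
have clS : closed S.
  rewrite (_ : S = (fun u : 'rV[R]_n => u^T) @^-1` K `&` f @^-1` [set x | x <=
    f q0^T]) //.
  by apply: closedI; apply: closed_comp.
have bS : bounded_set S.
  (* Coercivity bounds the square of the distance to [y] by [f q0^T / c]; as [m >= 1], that is at
     most [m ^+ 2], and no square root is needed. *)
  pose m := f q0^T / c + 1.
  exists (`|y| + m); split; first exact: num_real.
  move=> x mx u /= [_ fu]; apply: le_trans (ltW mx).
  have fq0 : 0 <= f q0^T.
    by apply: le_trans (cM _); rewrite mulr_ge0 ?exprn_ge0 // ltW.
  have m1 : 1 <= m by rewrite /m lerDr divr_ge0 // ltW.
  have : `|u^T - y| <= m.
    rewrite -(@ler_pXn2r _ 2) ?nnegrE //; last lra.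
    apply: (@le_trans _ _ m); last by rewrite expr2; apply: ler_peMl; lra.
    have : `|u^T - y| ^+ 2 <= f q0^T / c.
      by rewrite ler_pdivlMr // mulrC; apply: le_trans fu; exact: cM.
    by move=> /le_trans; apply; rewrite /m lerDl.
  rewrite -[`|u|]mx_norm_tr => Hm; rewrite -[u^T](subrK y).
  by apply: le_trans (ler_normD _ _) _; rewrite addrC lerD2l.
have [u0 u0S u0min] := compact_EVT_min (ex_intro _ _ Sq0)
  (bounded_closed_compact bS clS) (continuous_subspaceT cf).
have [Ku0 fu0] : S u0 by rewrite inE in u0S.
exists u0^T; split=> // q Kq.
have [fq|fq] := leP (f q^T) (f q0^T).
  have : q^T \in S by rewrite inE; split; rewrite ?trmxK.
  by move=> /u0min; rewrite /f !trmxK.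
by apply: le_trans fu0 _; apply: ltW; move: fq; rewrite /f !trmxK.
Qed.

Lemma spd_unitmx n (M : 'M[R]_n) : spd M -> M \in unitmx.
Proof.
move=> [_ M0]; rewrite -row_free_unit -kermx_eq0.
apply: contraT => /rowV0Pn [u uM u0]; move/sub_kermxP: uM => uM.
have := M0 u^T; rewrite -trmx0 (inj_eq trmx_inj) => /(_ u0).
by rewrite /qform trmxK uM mul0mx mxE ltxx.
Qed.

Lemma spd_inv n (M : 'M[R]_n) : spd M -> spd (invmx M).
Proof.
move=> sM; have uM := spd_unitmx sM; have [Ms M0] := sM; split.
  by rewrite trmx_inv Ms.
move=> v v0; have := M0 (invmx M *m v); rewrite /qform trmx_mul trmx_inv Ms.
rewrite -!mulmxA mulKVmx // => -> //.
by apply: contra v0 => /eqP E; rewrite -[v](mulKVmx uM) E mulmx0.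
Qed.

End quadratic_forms.

Section gradient_projection.
Context {R : realType} {k : nat}.
Implicit Types (Gamma : 'M[R]_k) (C : set 'cV[R]_k) (v y p q : 'cV[R]_k).

(** The projection is chosen by [get], which is meaningful only if a minimizer exists. The cone is
    closed by definition and contains 0, so coercivity provides one. *)
Lemma grad_projP Gamma C v y : spd Gamma -> C !=set0 ->
  tangent_cone C v (grad_proj Gamma C v y) /\
  forall q, tangent_cone C v q ->
    qform (invmx Gamma) (grad_proj Gamma C v y - y) <= qform (invmx Gamma) (q - y).
Proof.
move=> sG [v0 Cv0]; have [_ iG0] := spd_inv sG.
have T0 : tangent_cone C v 0.
  by apply: subset_closure; exists 0, v0; split; rewrite ?scale0r.
have [p Pp] := qform_minimizer y iG0 (@closed_closure _ _) T0.
exact: (@getPex _ [set p | tangent_cone C v p /\ forall q, tangent_cone C v q ->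
      qform (invmx Gamma) (p - y) <= qform (invmx Gamma) (q - y)] (ex_intro _ p
        Pp)).
Qed.

(* Also for [v] outside of [C]: directions of the tangent cone point back into
   a half-space containing [C]. *)
Lemma tangent_cone_halfspace (a : 'rV[R]_k) (b : R) C v p :
  (forall q, C q -> (a *m q) 0 0 <= b) -> b <= (a *m v) 0 0 ->
  tangent_cone C v p -> (a *m p) 0 0 <= 0.
Proof.
move=> Cb bv.
have cl : closed [set d : 'cV[R]_k | (a *m d) 0 0 <= 0].
  apply: (@closed_comp _ _ (fun d : 'cV[R]_k => (a *m d) 0 0) [set x : R | x <= 0]).
    move=> d _.
    have H : mx_cvg (F := nbhs d) (fun d => a *m d) (a *m d).
      by apply: mx_cvgM (mx_cvg_id d); exact: mx_cvg_cst.
    exact: mx_cvgE H 0 0.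
  exact: closed_le.
rewrite /tangent_cone => Tp; apply: cl; apply: closureS Tp =>
  _ [s [q [s0 Cq ->]]] /=.
have subE (x y : 'M[R]_1) : (x - y) 0 0 = x 0 0 - y 0 0 by rewrite !mxE.
rewrite -scalemxAr mxE mulmxBr subE.
by apply: mulr_ge0_le0 => //; have := Cb q Cq; lra.
Qed.

(** A generator [s (p - v)] plus [q - v] equals [(s + 1) (p' - v)], where [p'] is the convex
    combination of [p] and [q] with weights [s / (s + 1)] and [1 / (s + 1)]. Continuity of the
    translation carries this to the closure. *)
Lemma tangent_coneD C v d q : C v -> C q ->
  (forall x y (s t : R), C x -> C y -> 0 <= s -> 0 <= t -> s + t = 1 ->
    C (s *: x + t *: y)) ->
  tangent_cone C v d -> tangent_cone C v (d + (q - v)).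
Proof.
move=> Cv Cq cC; rewrite /tangent_cone => Td.
pose g x := x + (q - v).
have cg : continuous g by move=> x; exact: (cvgD (@cvg_id _ (nbhs x)) (cvg_cst _)).
set S := [set d | _] in Td *.
have gS : S `<=` g @^-1` S.
  move=> _ [s [p [s0 Cp ->]]]; have s10 : 0 < s + 1 by rewrite ltr_wpDl.
  exists (s + 1), ((s / (s + 1)) *: p + (1 / (s + 1)) *: q); split;
    first exact: ltW.
    apply: cC => //; rewrite ?divr_ge0 ?(ltW s10) //.
    by rewrite -mulrDl divff // gt_eqF.
  by rewrite /g; apply/colP => i; rewrite !mxE; field; rewrite gt_eqF.
have cl : closed (g @^-1` closure S) by apply: closed_comp => //;
  exact: closed_closure.
apply: cl; apply: closureS Td => x /gS Sx.
exact: (@subset_closure _ S).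
Qed.

(** First-order optimality: the minimizer may be moved by [h (q - v)] within the cone. Up to the
    factor 2, the two sides are the derivatives of the energy of [v - q] with and without
    projection. *)
Lemma grad_proj_variational Gamma C v y q : spd Gamma -> C v -> C q ->
  (forall x y (s t : R), C x -> C y -> 0 <= s -> 0 <= t -> s + t = 1 ->
    C (s *: x + t *: y)) ->
  ((v - q)^T *m invmx Gamma *m grad_proj Gamma C v y) 0 0 <=
  ((v - q)^T *m invmx Gamma *m y) 0 0.
Proof.
move=> sG Cv Cq cC; have [Tp pmin] := grad_projP v y sG (ex_intro _ _ Cv).
set p := grad_proj _ _ _ _ in Tp pmin *.
set G := invmx Gamma in pmin *; have [Gs _] := spd_inv sG; rewrite -/G in Gs.
have Th h : 0 <= h -> h <= 1 -> tangent_cone C v (p + h *: (q - v)).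
  move=> h0 h1.
  have -> : p + h *: (q - v) = p + ((h *: q + (1 - h) *: v) - v).
    by congr (p + _); apply/colP => i; rewrite !mxE; ring.
  by apply: tangent_coneD => //; apply: cC => //; lra.
pose b := ((v - q)^T *m G *m (p - y)) 0 0.
have key h : 0 <= h -> h <= 1 -> 2 * h * b <= h ^+ 2 * qform G (q - v).
  move=> h0 h1; have := pmin _ (Th h h0 h1).
  have -> : p + h *: (q - v) - y = (p - y) - h *: (v - q).
    by apply/colP => i; rewrite !mxE; ring.
  have -> : qform G (q - v) = qform G (v - q) by rewrite -qformN opprB.
  rewrite qformB_expand // -/b; lra.
suff : b <= 0.
  have subE (x z : 'M[R]_1) : (x - z) 0 0 = x 0 0 - z 0 0 by rewrite !mxE.
  by rewrite /b mulmxBr subE subr_le0.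
rewrite leNgt; apply/negP => b0.
pose Q := qform G (q - v).
have Q0 : 0 <= Q by have := key 1 ler01 (lexx _);
  rewrite expr1n mul1r mulr1 -/Q; lra.
(* For this [h], [h * Q <= b], so [key] gives [2 * h * b <= h * b], impossible for positive [h * b].
   The [+ b] ensures [h <= 1] and allows [Q = 0]. *)
pose h := b / (Q + b).
have Qb : 0 < Q + b by rewrite ltr_wpDl.
have h0 : 0 < h by rewrite divr_gt0.
have h1 : h <= 1 by rewrite ler_pdivrMr // mul1r lerDr.
have hQ : h * Q <= b by rewrite /h mulrAC ler_pdivrMr // ler_pM2l // lerDl ltW.
have := key h (ltW h0) h1; rewrite -/Q; clearbody h.
have : h * (h * Q) <= h * b by rewrite ler_pM2l.
have : 0 < h * b by rewrite mulr_gt0.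
lra.
Qed.

(** As 0 lies in the cone, the projection is no farther from [y] than 0 is. Its norm is then at most
    twice that of [y], whence the factor 4. *)
Lemma grad_proj_le Gamma C v y : spd Gamma -> C !=set0 ->
  qform (invmx Gamma) (grad_proj Gamma C v y) <= 4 * qform (invmx Gamma) y.
Proof.
move=> sG C0; have [_ pmin] := grad_projP v y sG C0.
have [Gs iG0] := spd_inv sG.
set p := grad_proj _ _ _ _ in pmin *; set G := invmx Gamma in pmin Gs iG0 *.
have T0 : tangent_cone C v 0.
  have [v0 Cv0] := C0.
  by apply: subset_closure; exists 0, v0; split; rewrite ?scale0r.
have := pmin 0 T0; rewrite sub0r qformN => H.
have -> : p = (p - y) - (-1) *: y by rewrite scaleN1r opprK subrK.
rewrite qformB_expand //.
have := qform_ge0 ((p - y) - 1 *: y) iG0; rewrite qformB_expand //; lra.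
Qed.

End gradient_projection.

(** * Bounded signals, pseudo-inverses and weights *)

Section bounded_signals.
Context {R : realType}.

Lemma bounded_signalP m n (x : R -> 'M[R]_(m, n)) :
  bounded_signal x <-> exists2 M, 0 < M & forall t, 0 <= t -> `|x t| <= M.
Proof.
split=> [[M [_ Mx]]|[M M0 Mx]].
  exists (Num.max 1 (M + 1)); first by rewrite lt_max ltr01.
  move=> t t0; apply: Mx; last by rewrite /= in_itv /= t0.
  by rewrite lt_max ltrDl ltr01 orbT.
exists M; split; first exact: num_real.
move=> N MN t /=; rewrite in_itv /= andbT => t0.
exact: le_trans (Mx t t0) (ltW MN).
Qed.

Lemma eq_bounded_signal m n (x y : R -> 'M[R]_(m, n)) :
  (forall t, 0 <= t -> y t = x t) -> bounded_signal x -> bounded_signal y.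
Proof.
move=> xy /bounded_signalP [M M0 xM]; apply/bounded_signalP; exists M => // t t0.
by rewrite xy // xM.
Qed.

Lemma bounded_signal_cst m n (c : 'M[R]_(m, n)) : bounded_signal (fun=> c).
Proof. by apply/bounded_signalP; exists (`|c| + 1) => [|t _];
  rewrite ?ltr_wpDl // lerDl. Qed.

Lemma bounded_signalD m n (x y : R -> 'M[R]_(m, n)) :
  bounded_signal x -> bounded_signal y -> bounded_signal (fun t => x t + y t).
Proof.
move=> /bounded_signalP [M M0 xM] /bounded_signalP [N N0 yN].
apply/bounded_signalP; exists (M + N) => [|t t0]; first exact: addr_gt0.
by apply: le_trans (ler_normD _ _) _; apply: lerD; [exact: xM|exact: yN].
Qed.

Lemma mx_norm_mulmx m n p (A : 'M[R]_(m, n)) (B : 'M[R]_(n, p)) :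
  `|A *m B| <= n%:R * (`|A| * `|B|).
Proof.
apply: mx_norm_le => [|i j]; first by rewrite !mulr_ge0.
rewrite mxE; apply: le_trans (ler_norm_sum _ _ _) _.
apply: (@le_trans _ _ (\sum_(l < n) `|A| * `|B|)); last first.
  by rewrite sumr_const card_ord mulr_natl.
by apply: ler_sum => l _; rewrite normrM; apply: ler_pM => //;
  exact: mx_entry_le_norm.
Qed.

Lemma bounded_signalM m n p (x : R -> 'M[R]_(m, n)) (y : R -> 'M[R]_(n, p)) :
  bounded_signal x -> bounded_signal y -> bounded_signal (fun t => x t *m y t).
Proof.
move=> /bounded_signalP [M M0 xM] /bounded_signalP [N N0 yN].
apply/bounded_signalP; exists (n%:R * (M * N) + 1) => [|t t0].
  by rewrite ltr_wpDl // mulr_ge0 // mulr_ge0 // ltW.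
apply: le_trans (mx_norm_mulmx _ _) _; apply: ler_wpDr => //.
by apply: ler_wpM2l => //; apply: ler_pM => //; [exact: xM|exact: yN].
Qed.

Lemma bounded_signalZ m n (c : R -> R) (M : R) (x : R -> 'M[R]_(m, n)) :
  (forall t, 0 <= t -> `|c t| <= M) ->
  bounded_signal x -> bounded_signal (fun t => c t *: x t).
Proof.
move=> cM /bounded_signalP [N N0 xN].
apply/bounded_signalP; exists (M * N + 1) => [|t t0].
  by rewrite ltr_wpDl // mulr_ge0 ?(ltW N0) // (le_trans _ (cM 0 _)).
rewrite normrZ; apply: ler_wpDr => //.
by apply: ler_pM => //; [exact: cM|exact: xN].
Qed.

Lemma bounded_signalB m n (x y : R -> 'M[R]_(m, n)) :
  bounded_signal x -> bounded_signal y -> bounded_signal (fun t => x t - y t).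
Proof.
move=> bx /(@bounded_signalZ _ _ (fun=> -1) 1) by_.
apply: (eq_bounded_signal (x := fun t => x t + -1 *: y t)).
  by move=> t _; rewrite scaleN1r.
by apply: bounded_signalD => //; apply: by_ => t _; rewrite normrN1.
Qed.

Lemma bounded_signal_sum m n (I : finType) (x : I -> R -> 'M[R]_(m, n)) :
  (forall i, bounded_signal (x i)) -> bounded_signal (fun t => \sum_i x i t).
Proof.
move=> bx; elim: (index_enum I) => [|i r IH].
  apply: (eq_bounded_signal _ (bounded_signal_cst 0)) => t _; exact: big_nil.
apply: (eq_bounded_signal _ (bounded_signalD (bx i) IH)) => t _; exact: big_cons.
Qed.

Lemma bounded_signal_entries m n (x : R -> 'M[R]_(m, n)) (M : R) :
  (forall t i j, 0 <= t -> `|x t i j| <= M) -> bounded_signal x.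
Proof.
move=> xM; apply/bounded_signalP; exists (`|M| + 1) => [|t t0];
  first by rewrite ltr_wpDl.
apply: mx_norm_le => [|i j]; first by rewrite addr_ge0.
by apply: le_trans (xM _ _ _ t0) _; apply: ler_wpDr (ler_norm _).
Qed.

Lemma bounded_family (I : finType) m n (x : I -> R -> 'M[R]_(m, n)) :
  (forall i, bounded_signal (x i)) ->
  exists2 b, 0 <= b & forall i t, 0 <= t -> `|x i t| <= b.
Proof.
move=> bx; have bi i : exists b, 0 <= b /\ forall t, 0 <= t -> `|x i t| <= b.
  have /bounded_signalP [b b0 Hb] := bx i.
  by exists b; split => //; exact: ltW.
have [b bP] := choice bi; exists (\sum_i b i).
  by apply: sumr_ge0 => i _; exact: (bP i).1.
move=> i t t0; apply: le_trans ((bP i).2 t t0) _; rewrite (bigD1 i) //= lerDl.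
by apply: sumr_ge0 => l _; exact: (bP l).1.
Qed.

End bounded_signals.

Section left_inverse.
Context {R : realType}.

Lemma sqnorm2_ge0 n (v : 'cV[R]_n) : 0 <= sqnorm2 v.
Proof. by apply: sumr_ge0 => i _; exact: sqr_ge0. Qed.

Lemma sqnorm2E n (v : 'cV[R]_n) : sqnorm2 v = (v^T *m v) 0 0.
Proof. by rewrite mxE; apply: eq_bigr => i _; rewrite mxE expr2. Qed.

Lemma sqnorm2_eq0 n (v : 'cV[R]_n) : sqnorm2 v = 0 -> v = 0.
Proof.
move/eqP; rewrite psumr_eq0 => [/allP v0|i _]; last exact: sqr_ge0.
apply/colP => i; rewrite mxE; have := v0 i (mem_index_enum _).
by rewrite sqrf_eq0 => /eqP.
Qed.

Lemma sqr_le_sqnorm2 n (v : 'cV[R]_n) i : v i 0 ^+ 2 <= sqnorm2 v.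
Proof.
by rewrite /sqnorm2 (bigD1 i) //= lerDl; apply: sumr_ge0 => j _; exact: sqr_ge0.
Qed.

Lemma full_column_rank_unitmx n m (B : 'M[R]_(n, m)) :
  full_column_rank B -> B^T *m B \in unitmx.
Proof.
move=> rB; rewrite -row_free_unit -kermx_eq0.
apply: contraT => /rowV0Pn [v /sub_kermxP vB v0].
have : sqnorm2 (B *m v^T) = 0.
  rewrite sqnorm2E trmx_mul trmxK -mulmxA [B^T *m _]mulmxA mulmxA vB mul0mx mxE //.
move/sqnorm2_eq0 => Bv.
have fB : row_free B^T by rewrite /row_free mxrank_tr rB.
have vBt : v *m B^T = 0 by rewrite -[LHS]trmxK trmx_mul trmxK Bv trmx0.
by rewrite -(row_free_inj fB (etrans vBt (esym (mul0mx _ _)))) eqxx in v0.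
Qed.

Lemma left_pinvK n m (B : 'M[R]_(n, m)) : full_column_rank B ->
  left_pinv B *m B = 1%:M.
Proof. by move=> /full_column_rank_unitmx uB; rewrite /left_pinv -mulmxA
  mulVmx. Qed.

Lemma mx_cvg_left_pinv (T : Type) (F : set_system T) (FF : Filter F) n m
    (B : T -> 'M[R]_(n, m)) (B0 : 'M[R]_(n, m)) : full_column_rank B0 ->
  mx_cvg (F := F) B B0 -> mx_cvg (F := F) (fun t => left_pinv (B t)) (left_pinv B0).
Proof.
move=> rB0 cB; have uB := full_column_rank_unitmx rB0.
have cBtB : mx_cvg (F := F) (fun t => (B t)^T *m B t) (B0^T *m B0).
  exact: mx_cvgM (mx_cvg_tr cB) cB.
apply: mx_cvgM (mx_cvg_tr cB); apply: mx_cvg_inv => //.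
have d0 : \det (B0^T *m B0) != 0 by rewrite -unitfE -unitmxE.
have : \det ((B t)^T *m B t) @[t --> F] --> \det (B0^T *m B0) by exact: mx_cvg_det.
move=> /cvgrPdist_lt cd.
have d0' : 0 < `|\det (B0^T *m B0)| by rewrite normr_gt0.
apply: filterS (cd _ d0') => t /= Ht.
rewrite unitmxE unitfE; apply/eqP => E.
by rewrite E subr0 ltxx in Ht.
Qed.

Lemma mx_cvg_sumZ (T : Type) (F : set_system T) (FF : Filter F) n m k
    (c : 'I_k -> T -> R) (c0 : 'I_k -> R) (B : 'I_k -> 'M[R]_(n, m)) :
  (forall i, c i t @[t --> F] --> c0 i) ->
  mx_cvg (F := F) (fun t => \sum_i c i t *: B i) (\sum_i c0 i *: B i).
Proof.
move=> cc; split=> a b; rewrite summxE.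
rewrite (_ : (fun t => _) = (fun t => \sum_i c i t * B i a b)); last first.
  by apply/funext => t; rewrite summxE; apply: eq_bigr => i _; rewrite mxE.
apply: cvg_big_sum => i; rewrite mxE; apply: cvgM; [exact: cc|exact: cvg_cst].
Qed.

Lemma convex_weights_le1 k (w : 'I_k -> R) i : convex_weights w -> w i <= 1.
Proof.
move=> [w0 <-]; rewrite (bigD1 i) //= lerDl; exact: sumr_ge0.
Qed.

(* The weights range over a compact set on which the pseudo-inverse is
   continuous. *)
Lemma left_pinv_bounded n m k (B : 'I_k -> 'M[R]_(n, m)) :
  (forall w, convex_weights w -> full_column_rank (\sum_i w i *: B i)) ->
  exists M, forall w : 'I_k -> R, convex_weights w ->
    `|left_pinv (\sum_i w i *: B i)| <= M.
Proof.
move=> rB; pose S := [set u : 'rV[R]_k | convex_weights (u 0)].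
have [S0|S0] := pselect (S !=set0); last first.
  exists 0 => w cw; exfalso; apply: S0; exists (\row_i w i).
  by apply: (eq_ind w (@convex_weights R k) cw); apply/funext => i; rewrite mxE.
have bS : bounded_set S.
  exists 1; split=> [|x x1 u Su]; first exact: num_real.
  apply: mx_norm_le => [|i j]; first lra.
  have := convex_weights_le1 j Su; rewrite (ord1 i); have [/(_ j) ? _] := Su.
  by rewrite ger0_norm //; lra.
have sumc : continuous (fun u : 'rV[R]_k => \sum_i u 0 i).
  move=> u; apply: (@cvg_big_sum _ _ (nbhs u)) => i.
  exact: coord_continuous.
have clS : closed S.
  rewrite (_ : S = \bigcap_i (fun u : 'rV[R]_k => u 0 i) @^-1` [set x | 0 <= x] `&`
     (fun u : 'rV[R]_k => \sum_i u 0 i) @^-1` [set 1]).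
    apply: closedI.
      apply: closed_bigI => i _; apply: closed_comp; last exact: closed_ge.
      by move=> u _; exact: coord_continuous.
    by apply: closed_comp; [move=> u _; exact: sumc|exact: closed_eq].
  apply/seteqP; split=> u [H1 H2]; split => //; first by move=> i _; exact: H1.
  by move=> i; exact: H1.
pose f (u : 'rV[R]_k) := `|left_pinv (\sum_i u 0 i *: B i)|.
have cf : {within S, continuous f}.
  apply: continuous_in_subspaceT => u; rewrite inE => Su.
  have H : mx_cvg (F := nbhs u) (fun x => left_pinv (\sum_i x 0 i *: B i))
      (left_pinv (\sum_i u 0 i *: B i)).
    apply: mx_cvg_left_pinv; first exact: rB.
    by apply: mx_cvg_sumZ => i; exact: coord_continuous.
  exact: cvg_norm (mx_cvgP H).
have [u0 _ uM] := compact_EVT_max S0 (bounded_closed_compact bS clS) cf.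
exists (f u0) => w cw; have E : (\row_i w i) 0 = w by apply/funext => i;
  rewrite mxE.
by have := uM (\row_i w i); rewrite inE /S /f /= E; exact.
Qed.

End left_inverse.

Section simplex.
Context {R : realType} {k : nat}.
Local Notation Pi := (@corner_simplex R k).

Lemma corner_simplex_convex (x y : 'cV[R]_k) (s t : R) : Pi x -> Pi y ->
  0 <= s -> 0 <= t -> s + t = 1 -> Pi (s *: x + t *: y).
Proof.
move=> [x01 sx] [y01 sy] s0 t0 st; split=> [i|].
  rewrite !mxE; have /andP[x0 x1] := x01 i; have /andP[y0 y1] := y01 i.
  rewrite addr_ge0 ?mulr_ge0 //= -st; apply: lerD; exact: ler_piMr.
under eq_bigr do rewrite !mxE.
rewrite big_split -!mulr_sumr /= -st; apply: lerD; exact: ler_piMr.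
Qed.

(** The simplex is cut out by half-spaces, each kept by the barrier lemma. Since the solution is not
    yet known to stay inside, the projection must be controlled at outside points too, which
    [tangent_cone_halfspace] does. *)
Lemma corner_simplex_invariant (Gamma : 'M[R]_k) (v y : R ->
  'cV[R]_k) : spd Gamma ->
  vec_solution v (fun t => grad_proj Gamma Pi (v t) (y t)) -> Pi (v 0) ->
  forall t, 0 <= t -> Pi (v t).
Proof.
move=> sG sv Pv0 t t0.
have half (a : 'rV[R]_k) (b : R) : (forall q, Pi q -> (a *m q) 0 0 <= b) ->
    (a *m v t) 0 0 <= b.
  move=> ab; apply: (ae_solution_barrier (vec_solution_mulmx a sv 0) (lexx 0)) t0.
    exact: ab.
  move=> s s0 bs; apply: tangent_cone_halfspace ab bs _.
  by apply: (grad_projP _ _ sG _).1; exists (v 0).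
have ge0 i : 0 <= v t i 0.
  have := half (- delta_mx 0 i) 0.
  rewrite mulNmx -rowE !mxE oppr_le0; apply => q [q01 _].
  by rewrite mulNmx -rowE !mxE oppr_le0; have /andP[] := q01 i.
have le1 : \sum_i v t i 0 <= 1.
  have E q : (const_mx 1 *m q : 'M[R]_1) 0 0 = \sum_(i < k) q i 0.
    by rewrite mxE; apply: eq_bigr => i _; rewrite mxE mul1r.
  by rewrite -E; apply: half => q [_]; rewrite E.
split=> // i; rewrite ge0 /=; apply: le_trans le1.
by rewrite (bigD1 i) //= lerDl; apply: sumr_ge0.
Qed.

Lemma corner_simplex_weights (v : 'cV[R]_k) (w : 'I_k.+1 -> R) : Pi v ->
  (forall j, w (init_ord j) = v j 0) -> w ord_max = 1 - \sum_j v j 0 ->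
    convex_weights w.
Proof.
move=> [v01 sv] wj wN; split.
  move=> i; case: (unliftP ord_max i) => [j ->|->]; last by rewrite wN subr_ge0.
  have -> : lift ord_max j = init_ord j by apply: val_inj;
    rewrite /= /bump leqNgt ltn_ord.
  by rewrite wj; have /andP[] := v01 j.
rewrite big_ord_recr /= wN (eq_bigr (fun j => v j 0)); first by rewrite addrC subrK.
by move=> j _; exact: wj.
Qed.

Lemma weights_corner_simplex (w : 'I_k.+1 -> R) : convex_weights w ->
  Pi (\col_j w (init_ord j)).
Proof.
move=> cw; split=> [i|]; first by rewrite mxE cw.1 convex_weights_le1.
under eq_bigr do rewrite mxE.
have [w0 <-] := cw; rewrite big_ord_recr /= lerDl; exact: w0.
Qed.

(** Eliminates the last weight, as the columns of [E] do by taking differences with the last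
    error. *)
Lemma sum_weights_last (V : lmodType R) (w : 'I_k.+1 -> R) (x : 'I_k.+1 -> V) :
  \sum_i w i = 1 -> \sum_i w i *: x i =
  x ord_max + \sum_j w (init_ord j) *: (x (init_ord j) - x ord_max).
Proof.
rewrite !big_ord_recr /= => w1; rewrite (_ : w ord_max = 1 - \sum_j w (init_ord
  j)); last first.
  by move: w1; rewrite /init_ord; lra.
rewrite addrC scalerBl scale1r -addrA; congr (_ + _).
rewrite scaler_suml -sumrN addrC -big_split /=.
by apply: eq_bigr => j _; rewrite scalerBr.
Qed.

End simplex.

(** A hull combination may use a corner repeatedly or not at all. Each of its points is assigned one
    corner index, and the weights with the same index are added up. *)
Lemma conv_hull_range_weights (R : realType) (V : lmodType R) k (x : 'I_k -> V) p :
  conv_hull (range x) p -> exists w, convex_weights w /\ p = \sum_i w i *: x i.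
Proof.
move=> [l [y [v [yx [v0 v1] ->]]]].
have xy i : {j | y i = x j}.
  by apply: cid; have [j _ <-] := yx i; exists j.
exists (fun j => \sum_(i | sval (xy i) == j) v i); split; first split.
- by move=> j; exact: sumr_ge0.
- by rewrite -v1 (partition_big (fun i => sval (xy i)) xpredT).
rewrite (partition_big (fun i => sval (xy i)) xpredT) //=; apply: eq_bigr => j _.
rewrite scaler_suml; apply: eq_bigr => i /eqP <-.
by congr (_ *: _); exact: svalP (xy i).
Qed.

(** * Persistent excitation *)

Section excitation.
Context {R : realType}.

(** Turns excitation bounds into bounds on increments of a solution, which [ae_solution_le] can
    compare with derivative inequalities. *)
Lemma gramian_qform q (Phi : R -> 'cV[R]_q) (v : 'cV[R]_q) :
  (forall i, halfline_continuous (fun t => Phi t i 0)) ->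
  exists G, ae_solution G (fun t => (v^T *m Phi t) 0 0 ^+ 2) /\
    forall t T, 0 <= t -> 0 <= T -> qform (gramian Phi t T) v = G (t + T) - G t.
Proof.
move=> cP.
have exH (ij : 'I_q * 'I_q) : exists H, ae_solution H (fun t =>
  Phi t ij.1 0 * Phi t ij.2 0) /\
    forall a b, 0 <= a -> a <= b ->
    \int[@lebesgue_measure R]_(t in `[a, b]) (Phi t ij.1 0 * Phi t ij.2 0) = H
      b - H a.
  by apply: halfline_antiderivative; exact: halfline_continuousM.
have [H HP] := choice exH.
exists (fun t => \sum_i \sum_j v i 0 * (v j 0 * H (i, j) t)); split.
  have S := ae_solution_sum (index_enum 'I_q) (fun i =>
    ae_solution_sum (index_enum 'I_q) (fun j =>
    ae_solutionZ (v i 0) (ae_solutionZ (v j 0) (HP (i, j)).1))).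
  apply: eq_ae_solution S => // t _ /=.
  rewrite mxE expr2 big_distrl /=; apply: eq_bigr => i _.
  rewrite big_distrr /=; apply: eq_bigr => j _.
  by rewrite !mxE; ring.
move=> t T t0 T0; rewrite /qform -mulmxA mxE -sumrB; apply: eq_bigr => i _.
rewrite !mxE -sumrB big_distrr /=; apply: eq_bigr => j _.
rewrite mxE -mulrBr -mulrBr -(HP (i, j)).2 ?lerDl //= [v j 0 * _]mulrC.
congr (_ * (_ * _)); apply: eq_Rintegral => s _.
by rewrite mxE big_ord1 mxE.
Qed.

Lemma qform_scalar n (a : R) (v : 'cV[R]_n) : qform a%:M v = a * sqnorm2 v.
Proof. by rewrite /qform mul_mx_scalar -scalemxAl mxE sqnorm2E. Qed.

Lemma qformBl n (M P : 'M[R]_n) v : qform (M - P) v = qform M v - qform P v.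
Proof.
rewrite /qform mulmxBr mulmxBl; move: (_ *m M *m v) (_ *m P *m v) => x y.
by rewrite !mxE.
Qed.

Lemma sqnorm2_delta n (i : 'I_n) : sqnorm2 (delta_mx i 0 : 'cV[R]_n) = 1.
Proof. by rewrite sqnorm2E trmx_delta -rowE !mxE !eqxx. Qed.

Lemma sqnorm2_solution n (x g : R -> 'cV[R]_n) : vec_solution x g ->
  ae_solution (fun t => sqnorm2 (x t)) (fun t => 2 * ((x t)^T *m g t) 0 0).
Proof.
move=> sx.
have S := ae_solution_sum (index_enum 'I_n) (fun i => ae_solutionM (sx i) (sx i)).
apply: eq_ae_solution S => [t _|].
  by rewrite mxE big_distrr /=; apply: eq_bigr => i _; rewrite mxE; ring.
by apply/funext => t; apply: eq_bigr => i _; rewrite expr2.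
Qed.

(** Each window of length [T] contains a time with [S <= c' / T + 1], otherwise the integral of [S]
    over it would exceed [c']. From that time to the end of the window, integrating [c * (1 + S)]
    adds at most [c * (T + c')]. *)
Lemma persistently_exciting_bounded q (Phi g : R -> 'cV[R]_q) (c : R) : 0 <= c ->
  vec_solution Phi g ->
  (forall t, 0 <= t -> 2 * ((Phi t)^T *m g t) 0 0 <= c * (1 + sqnorm2 (Phi t))) ->
  persistently_exciting Phi -> exists M, forall t, 0 <= t -> sqnorm2 (Phi t) <= M.
Proof.
move=> c0 sP gc [a1 [a2 [T [a10 a20 T0 PE]]]].
have sS := sqnorm2_solution sP.
pose S t := sqnorm2 (Phi t).
have S0 t : 0 <= S t by exact: sqnorm2_ge0.
have cP i : halfline_continuous (fun t => Phi t i 0) by exact: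
  ae_solution_continuous (sP i).
have [Gi GiP] := choice (fun i => gramian_qform (delta_mx i 0) cP).
pose G t := \sum_i Gi i t.
have sG : ae_solution G S.
  have H := ae_solution_sum (index_enum 'I_q) (fun i => (GiP i).1).
  apply: eq_ae_solution H => // t _.
  by apply: eq_bigr => i _; rewrite trmx_delta -rowE mxE.
(* The integral of [S] over a window is the trace of the Gramian: one [a2] for each basis vector. *)
pose c' := q%:R * a2.
have Gc t : 0 <= t -> G (t + T) - G t <= c'.
  move=> t0; rewrite /G -sumrB /c' mulr_natl -[X in _ *+ X]card_ord -sumr_const.
  apply: ler_sum => i _; rewrite -(GiP i).2 //; last exact: ltW.
  have [_ /(_ (delta_mx i 0))] := PE t t0.
  by rewrite qformBl subr_ge0 qform_scalar sqnorm2_delta mulr1.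
have c'0 : 0 <= c' by rewrite mulr_ge0 // ltW.
have Gmono a b : 0 <= a -> a <= b -> G a <= G b.
  move=> a0 ab; have := ae_solution_le (ae_solution_cst 0) sG a0 ab.
  by rewrite subrr subr_ge0; apply => t _; exact: S0.
have grow a b : 0 <= a -> a <= b -> b - a <= T -> G b - G a <= c' ->
    S b <= S a + c * (T + c').
  move=> a0 ab abT Gab.
  have := ae_solution_le sS (ae_solutionZ c (ae_solutionD ae_solution_id sG)) a0 ab.
  move=> H; have {H} : S b - S a <= c * (b + G b) - c * (a + G a).
    by apply: H => t /andP[at_ _]; apply: gc; lra.
  have : c * (b - a + (G b - G a)) <= c * (T + c') by apply: ler_wpM2l => //; lra.
  lra.
(* Growth is counted from time 0 when [t <= T], and from a time with [S <= c' / T + 1] otherwise. *)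
exists (S 0 + (c' / T + 1) + c * (T + c')) => t t0; rewrite -/(S t).
have cT0 : 0 <= c' / T by rewrite divr_ge0 // ltW.
have [tT|Tt] := leP t T.
  have : G t - G 0 <= c'.
    by have := Gc 0 (lexx _); have := Gmono t T t0 tT; rewrite add0r; lra.
  by move=> /(grow 0 t (lexx _) t0); rewrite subr0 => /(_ tT); lra.
have tT0 : 0 <= t - T by lra.
have [s [st [sT Ss]]] : exists s, s <= t /\ t - T <= s /\ S s <= c' / T + 1.
  apply: contrapT => nS.
  have H := ae_solution_le (ae_solutionZ (c' / T + 1) ae_solution_id) sG tT0 _ _.
  have {H} : (c' / T + 1) * t - (c' / T + 1) * (t - T) <= G t - G (t - T).
    apply: H; first lra.
    move=> s /andP[s1 s2]; rewrite mulr1 leNgt; apply/negP => Ss.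
    by apply: nS; exists s; split=> //; split=> //; exact: ltW.
  have -> : (c' / T + 1) * t - (c' / T + 1) * (t - T) = c' + T.
    by field; rewrite gt_eqF.
  have := Gc _ tT0; rewrite subrK; lra.
have : G t - G s <= c'.
  by have := Gc _ tT0; have := Gmono (t - T) s tT0 sT; rewrite subrK; lra.
move=> /(grow s t); have := S0 0; move=> ? H.
by have := H ltac:(lra) st ltac:(lra); lra.
Qed.

(** For an antiderivative [H] of some [h], the integrals of [h] over windows of fixed length become
    small, a weaker property than convergence of [h] to zero. *)
Definition vanishing_increments (H : R -> R) : Prop :=
  forall T e : R, 0 <= T -> 0 < e ->
    exists2 t0, 0 <= t0 & forall t, t0 <= t -> H (t + T) - H t <= e.

Lemma energy_vanishing_increments (W H : R -> R) : (forall t, 0 <= t -> 0 <= W t) ->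
  (forall a b, 0 <= a -> a <= b -> H a <= H b) ->
  (forall a b, 0 <= a -> a <= b -> H b - H a <= W a - W b) ->
  vanishing_increments H.
Proof.
move=> W0 Hmono HW T e T0 e0.
(* Once [W] is within [e] of its infimum it can drop by at most [e], and its drop bounds the
   increment of [H]. *)
pose A := [set W t | t in [set t | 0 <= t]].
have iA : has_inf A.
  split; first by exists (W 0); exists 0 => //=.
  by exists 0 => _ [t /= t0 <-]; exact: W0.
have [_ [t0 /= t00 <-] Wt0] := inf_adherent e0 iA.
exists t0 => // t t0t.
have t_0 : 0 <= t by lra.
have : inf A <= W (t + T).
  by apply: ge_inf; [exact: iA.2|exists (t + T) => //=; lra].
have := HW t0 t t00 t0t; have := Hmono t0 t t00 t0t.
have := HW t (t + T) t_0; rewrite lerDl => /(_ T0); lra.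
Qed.

(** In place of the Cauchy-Schwarz inequality over a window, the pointwise bound
    [|p| <= e + c / e * h] is used, since it is an inequality between derivatives and integrates. *)
Lemma slow_variation (f p h H : R -> R) (c : R) : 0 <= c -> ae_solution f p ->
  ae_solution H h -> (forall t, 0 <= t -> p t ^+ 2 <= c * h t) ->
    (forall t, 0 <= t -> 0 <= h t) ->
  vanishing_increments H -> forall T d : R, 0 < T -> 0 < d ->
  exists t0, 0 <= t0 /\
    forall t s, t0 <= t -> t <= s -> s <= t + T -> `|f s - f t| <= d.
Proof.
move=> c0 sf sH pc h0 vH T d T0 d0.
(* Over a window the constant part [e] contributes at most [d / 2], and [z] is chosen so that
   [c / e * h] does too; [c + 1] allows [c = 0]. *)
pose e := d / (2 * T); have e0 : 0 < e by rewrite divr_gt0 // mulr_gt0.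
pose z := d * e / (2 * (c + 1)).
have c10 : 0 < c + 1 by lra.
have z0 : 0 < z by apply: divr_gt0; apply: mulr_gt0.
have [t0 t00 Ht] := vH T z (ltW T0) z0.
exists t0; split=> // t s t0t ts st.
have t_0 : 0 <= t by lra.
have ce0 : 0 <= c / e by rewrite divr_ge0 // ltW.
have pb r : t <= r -> `|p r| <= e + c / e * h r.
  move=> tr; have r0 : 0 <= r by lra.
  rewrite -(ler_pM2l e0).
  have -> : e * (e + c / e * h r) = e ^+ 2 + c * h r by field; rewrite gt_eqF.
  have := pc r r0; rewrite -(real_normK (num_real (p r))).
  have := sqr_ge0 (e - `|p r|); have := sqr_ge0 e; have := mulr_ge0 c0 (h0 r r0).
  rewrite sqrrB; lra.
have sF := ae_solutionD (ae_solutionZ e ae_solution_id) (ae_solutionZ (c / e) sH).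
have up := ae_solution_le sf sF t_0 ts.
have dn := ae_solution_le (ae_solutionZ (-1) sf) sF t_0 ts.
have Hs : H s - H t <= z.
  have ts0 : 0 <= s by lra.
  have := ae_solution_le (ae_solution_cst 0) sH ts0 st.
  rewrite subrr => /(_ _); have := Ht t t0t; move=> ? K.
  have := K ltac:(move=> r /andP[? _]; apply: h0; lra); lra.
have bound : e * s + c / e * H s - (e * t + c / e * H t) <= d.
  have es : e * (s - t) <= d / 2.
    apply: (@le_trans _ _ (e * T)); first by rewrite ler_pM2l //; lra.
    by rewrite /e le_eqVlt; apply/orP; left; apply/eqP; field; rewrite gt_eqF.
  have : c / e * (H s - H t) <= d / 2.
    apply: (@le_trans _ _ (c / e * z)); first exact: ler_wpM2l.
    have -> : c / e * z = c / (c + 1) * (d / 2).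
      by rewrite /z; field; rewrite !gt_eqF.
    by apply: ler_piMl; [lra|rewrite ler_pdivrMr //; lra].
  lra.
have up' : f s - f t <= d.
  apply: le_trans bound; apply: up => r /andP[tr _].
  by rewrite mulr1; apply: le_trans (pb r tr); exact: ler_norm.
have dn' : -1 * f s - -1 * f t <= d.
  apply: le_trans bound; apply: dn => r /andP[tr _].
  by rewrite mulr1 mulN1r; apply: le_trans (pb r tr); rewrite -normrN;
    exact: ler_norm.
rewrite ler_norml; lra.
Qed.

(** The excitation inequality concerns a constant vector, so a row [u] of [Theta] is frozen at the
    start [t] of a window. Replacing [Theta t] by the current [Theta s] costs little, as the
    coordinates of [v] vary slowly, and [Theta s *m Phi s] is small in mean square. The [N j] may be
    dependent: only their combination is identified. *)
Lemma persistently_exciting_identifies n q k (Phi : R -> 'cV[R]_q) (v p : R ->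
  'cV[R]_k)
    (N : 'I_k -> 'M[R]_(n, q)) (h H : R -> R) (c : R) :
  let Theta t := \sum_j v t j 0 *: N j in 0 <= c ->
  (forall i, halfline_continuous (fun t => Phi t i 0)) -> bounded_signal Phi ->
  persistently_exciting Phi -> vec_solution v p -> ae_solution H h ->
  vanishing_increments H -> (forall t, 0 <= t -> 0 <= h t) ->
  (forall t j, 0 <= t -> p t j 0 ^+ 2 <= c * h t) ->
  (forall t, 0 <= t -> sqnorm2 (Theta t *m Phi t) <= c * h t) ->
  mx_cvg (F := +oo) Theta 0.
Proof.
move=> Theta c0 cP bP [a1 [a2 [T [a10 a20 T0 PE]]]] sv sH vH h0 pc Tc.
have [b b0 Nb] : exists2 b, 0 <= b & forall j t i, 0 <= t ->
  `|(N j *m Phi t) i 0| <= b.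
  have bN j : bounded_signal (fun t => N j *m Phi t).
    by apply: bounded_signalM => //; exact: bounded_signal_cst.
  have [b b0 Hb] := bounded_family bN; exists b => // j t i t0.
  exact: le_trans (mx_entry_le_norm _ _ _) (Hb j t t0).
pose C := k%:R * b; have C0 : 0 <= C by rewrite mulr_ge0.
have CT0 : 0 <= 4 * C ^+ 2 * T by rewrite !mulr_ge0 ?exprn_ge0 // ltW.
have small i (e : R) : 0 < e -> exists2 t0, 0 <= t0 & forall t, t0 <= t ->
    a1 * sqnorm2 (row i (Theta t))^T <= e.
  (* The cap at 1 gives [d ^+ 2 <= d], so a bound linear in [d] suffices for the variation of [v] to
     contribute at most [e / 2]; [z] below leaves the other half to the energy. *)
  move=> e0; pose d := Num.min 1 (e / (4 * C ^+ 2 * T + 1)).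
  have d0 : 0 < d by rewrite lt_min ltr01 divr_gt0 //; lra.
  have d1 : d <= 1 by rewrite ge_min lexx.
  have de : 4 * C ^+ 2 * T * d ^+ 2 <= e.
    have dle : d <= e / (4 * C ^+ 2 * T + 1) by rewrite ge_min lexx orbT.
    rewrite ler_pdivlMr in dle; last lra.
    have : d ^+ 2 <= d by rewrite expr2 ler_piMl // ltW.
    move=> dd; apply: (@le_trans _ _ (4 * C ^+ 2 * T * d)); first exact: ler_wpM2l.
    lra.
  pose z := e / (4 * (c + 1)); have z0 : 0 < z by rewrite divr_gt0 // mulr_gt0
    //; lra.
  have [t1 t10 H1] := vH T z (ltW T0) z0.
  have sl j := slow_variation c0 (sv j) sH (fun t => @pc t j) h0 vH T0 d0.
  have [tf tfP] := choice sl.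
  (* The sum of nonnegative times serves as an upper bound for all of them. *)
  exists (t1 + \sum_j tf j) => [|t tt].
    by rewrite addr_ge0 //; apply: sumr_ge0 => j _; exact: (tfP j).1.
  have sum0 : 0 <= \sum_j tf j by apply: sumr_ge0 => j _; exact: (tfP j).1.
  have t0 : 0 <= t by lra.
  have tfle j : tf j <= t.
    apply: le_trans tt; rewrite (bigD1 j) //=.
    have : 0 <= \sum_(l | l != j) tf l by apply: sumr_ge0 => l _; exact: (tfP l).1.
    lra.
  set u := (row i (Theta t))^T.
  have [G [sG GE]] := gramian_qform u cP.
  have [/(_ u) PEu _] := PE t t0.
  have {PEu} : a1 * sqnorm2 u <= G (t + T) - G t.
    rewrite -GE //; last exact: ltW.
    by move: PEu; rewrite qformBl subr_ge0 qform_scalar.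
  move=> /le_trans; apply.
  have sF := ae_solutionD (ae_solutionZ (2 * c) sH) (ae_solutionZ (2 * C ^+ 2 *
    d ^+ 2) ae_solution_id).
  have K : G (t + T) - G t <= 2 * c * H (t + T) + 2 * C ^+ 2 * d ^+ 2 * (t + T) -
      (2 * c * H t + 2 * C ^+ 2 * d ^+ 2 * t).
    apply: ae_solution_le sG sF t0 _ _; first by rewrite lerDl ltW.
    move=> s /andP[ts sT]; have s0 : 0 <= s by lra.
    rewrite mulr1 -mulrA.
    have -> : (u^T *m Phi s) 0 0 = (Theta t *m Phi s) i 0.
      by rewrite /u trmxK -row_mul mxE.
    have -> : (Theta t *m Phi s) i 0 =
       (Theta s *m Phi s) i 0 + \sum_j (v t j 0 - v s j 0) * (N j *m Phi s) i 0.
      rewrite /Theta !mulmx_suml !summxE -big_split /=; apply: eq_bigr => j _.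
      by rewrite -!scalemxAl [in LHS]mxE [X in _ = X + _]mxE; ring.
    have H2 : (Theta s *m Phi s) i 0 ^+ 2 <= c * h s.
      by apply: le_trans (Tc s s0); exact: sqr_le_sqnorm2.
    have H3 : `|\sum_j (v t j 0 - v s j 0) * (N j *m Phi s) i 0| <= C * d.
      apply: le_trans (ler_norm_sum _ _ _) _.
      apply: (@le_trans _ _ (\sum_(j < k) b * d)); last first.
        by rewrite sumr_const card_ord /C -[b * d *+ k]mulr_natl mulrA.
      apply: ler_sum => j _; rewrite normrM mulrC; apply: ler_pM => //;
        first exact: Nb.
      by rewrite distrC; apply: (tfP j).2.
    move: H2 H3; move: (_ i 0) (\sum_j _) => x y H2 H3.
    have H4 : y ^+ 2 <= C ^+ 2 * d ^+ 2.
      rewrite -exprMn -(real_normK (num_real y)).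
      by rewrite ler_pXn2r ?nnegrE // mulr_ge0 // ltW.
    have := sqr_ge0 (x - y); rewrite sqrrB sqrrD; lra.
  apply: le_trans K _.
  have cz : 2 * c * z <= e / 2.
    have -> : 2 * c * z = c / (c + 1) * (e / 2) by rewrite /z; field;
      rewrite gt_eqF //; lra.
    by apply: ler_piMl; [lra|rewrite ler_pdivrMr ?mul1r //; lra].
  have : 2 * c * (H (t + T) - H t) <= 2 * c * z.
    by apply: ler_wpM2l; [lra|apply: H1; lra].
  lra.
split=> i l; rewrite mxE.
apply: (@cvg0_sqr_le _ _ (fun t => sqnorm2 (row i (Theta t))^T)); last first.
  move=> t _; apply: le_trans (sqr_le_sqnorm2 _ l).
  by rewrite !mxE.
apply/cvgrPdist_le => /= e e0.
have [t0 t00 Ht] := small i _ (mulr_gt0 a10 e0).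
exists t0; split; first exact: num_real.
move=> t tt; rewrite sub0r normrN ger0_norm ?sqnorm2_ge0 //.
by have := Ht t (ltW tt); rewrite ler_pM2l.
Qed.

End excitation.

(** * The adaptive law *)

Section adaptive_law.
Context {R : realType}.

Lemma sqnorm2_le n (v : 'cV[R]_n) : sqnorm2 v <= n%:R * `|v| ^+ 2.
Proof.
apply: (@le_trans _ _ (\sum_(i < n) `|v| ^+ 2)); last first.
  by rewrite sumr_const card_ord mulr_natl.
apply: ler_sum => i _; rewrite -(real_normK (num_real (v i 0))).
by rewrite ler_pXn2r ?nnegrE //; exact: mx_entry_le_norm.
Qed.

Lemma norm_sqr_le n (v : 'cV[R]_n) : `|v| ^+ 2 <= sqnorm2 v.
Proof.
have S0 := sqnorm2_ge0 v.
rewrite -[leRHS](sqr_sqrtr S0) ler_pXn2r ?nnegrE ?sqrtr_ge0 //.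
apply: mx_norm_le => [|i j]; first exact: sqrtr_ge0.
by rewrite (ord1 j) -sqrtr_sqr ler_wsqrtr // sqr_le_sqnorm2.
Qed.

Lemma sqnorm2_young n (x d : 'cV[R]_n) (s : R) : 0 <= s <= 1 ->
  sqnorm2 x / 2 - sqnorm2 d / 2 <= (x^T *m (x + s *: d)) 0 0.
Proof.
move=> /andP[s0 s1]; rewrite /sqnorm2 !mulr_suml -sumrB mxE; apply: ler_sum => i _.
rewrite !mxE; move: (x i 0) (d i 0) => p q.
have : (s * q) ^+ 2 <= q ^+ 2 by rewrite exprMn ler_piMl ?sqr_ge0 // exprn_ile1.
have := sqr_ge0 (p + s * q); rewrite sqrrD; lra.
Qed.

Lemma sqnorm2D_le n (x d : 'cV[R]_n) (s : R) : 0 <= s <= 1 ->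
  sqnorm2 (x + s *: d) <= 2 * (sqnorm2 x + sqnorm2 d).
Proof.
move=> /andP[s0 s1]; rewrite /sqnorm2 -big_split /= big_distrr /=.
apply: ler_sum => i _; rewrite !mxE; move: (x i 0) (d i 0) => p q.
have : (s * q) ^+ 2 <= q ^+ 2 by rewrite exprMn ler_piMl ?sqr_ge0 // exprn_ile1.
have := sqr_ge0 (p - s * q); rewrite sqrrB sqrrD; lra.
Qed.

Lemma qform_le n (M : 'M[R]_n) :
  exists2 c, 0 <= c & forall v : 'cV[R]_n, qform M v <= c * `|v| ^+ 2.
Proof.
exists (n%:R * (n%:R * `|M|)) => [|v]; first by rewrite !mulr_ge0.
rewrite /qform; apply: le_trans (ler_norm _) _.
apply: le_trans (mx_entry_le_norm _ _ _) _; apply: le_trans (mx_norm_mulmx _ _) _.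
rewrite -mulrA; apply: ler_wpM2l => //.
rewrite expr2 mulrA; apply: ler_wpM2r => //.
apply: le_trans (mx_norm_mulmx _ _) _.
by rewrite mx_norm_tr -mulrA [`|v| * _]mulrC.
Qed.

Lemma qform_solution n (M : 'M[R]_n) (x g : R -> 'cV[R]_n) : M^T = M ->
  vec_solution x g ->
  ae_solution (fun t => qform M (x t)) (fun t => 2 * ((x t)^T *m M *m g t) 0 0).
Proof.
move=> Ms sx.
have S := ae_solution_sum (index_enum 'I_n) (fun i => ae_solutionM (sx i)
  (vec_solution_mulmx M sx i)).
apply: eq_ae_solution S => [t _|].
  rewrite big_split /= -(_ : ((x t)^T *m M *m g t) 0 0 = \sum_i x t i 0 * (M *m
    g t) i 0).
    rewrite -(_ : ((g t)^T *m M *m x t) 0 0 = \sum_i g t i 0 * (M *m x t) i 0).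
      by rewrite mulmx11_sym //; ring.
    by rewrite -mulmxA mxE; apply: eq_bigr => i _; rewrite mxE.
  by rewrite -mulmxA mxE; apply: eq_bigr => i _; rewrite mxE.
apply/funext => t; rewrite /qform -mulmxA mxE; apply: eq_bigr => i _.
by rewrite [X in _ = X * _]mxE.
Qed.

Local Notation Pi := (@corner_simplex R _).

(** Here [v0] stands for exact weights: with them the estimation error is only the transient [d]
    scaled by the inverse normalization [s]. *)
Lemma adaptive_law_energy n k (Gamma : 'M[R]_k) (v : R -> 'cV[R]_k) (v0 : 'cV[R]_k)
    (E : R -> 'M[R]_(n, k)) (e d : R -> 'cV[R]_n) (s H : R -> R) (lambda : R) :
  let y t := - (Gamma *m ((E t)^T *m E t *m v t + (E t)^T *m e t)) in
  spd Gamma -> 0 < lambda -> Pi v0 ->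
  vec_solution v (fun t => grad_proj Gamma Pi (v t) (y t)) ->
  (forall t, 0 <= t -> Pi (v t)) ->
  (forall t, 0 <= t -> 0 <= s t <= 1) ->
  (forall t, 0 <= t -> E t *m v0 + e t = s t *: d t) ->
  vec_solution d (fun t => - lambda *: d t) ->
  ae_solution H (fun t => sqnorm2 (E t *m (v t - v0)) + sqnorm2 (d t)) ->
  vanishing_increments H.
Proof.
move=> y sG l0 Pv0 sv Pv s01 Ee sd sH.
have [Gs iG0] := spd_inv sG; have uG := spd_unitmx sG.
have sw := vec_solutionBc v0 sv.
(* The factor [lambda^-1] makes the transient contribute [- 2 |d|^2]: one half absorbs the cross
   term of [E (v - v0)] with [s d], the other remains in the derivative of [H]. *)
pose W t := qform (invmx Gamma) (v t - v0) + lambda^-1 * sqnorm2 (d t).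
have sW := ae_solutionD (qform_solution Gs sw) (ae_solutionZ lambda^-1
  (sqnorm2_solution sd)).
have h0 t : 0 <= sqnorm2 (E t *m (v t - v0)) + sqnorm2 (d t).
  by apply: addr_ge0; exact: sqnorm2_ge0.
apply: (@energy_vanishing_increments _ W).
- move=> t _; apply: addr_ge0; first exact: qform_ge0.
  by rewrite mulr_ge0 ?sqnorm2_ge0 // invr_ge0 ltW.
- move=> a b a0 ab; have := ae_solution_le (ae_solution_cst 0) sH a0 ab.
  by rewrite subrr subr_ge0; apply => t _; exact: h0.
move=> a b a0 ab.
have := ae_solution_le sH (ae_solutionZ (-1) sW) a0 ab.
rewrite -/(W b) -/(W a) => K; suff : H b - H a <= -1 * W b - -1 * W a by lra.
apply: K => t /andP[at_ _]; have t0 : 0 <= t by lra.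
(* The direction from the estimate to the exact weights is tangent because both lie in the
   simplex. *)
have var := grad_proj_variational (y t) sG (Pv t t0) Pv0
  (@corner_simplex_convex _ _).
have yE : ((v t - v0)^T *m invmx Gamma *m y t) 0 0 =
    - ((E t *m (v t - v0))^T *m (E t *m (v t - v0) + s t *: d t)) 0 0.
  rewrite /y mulmxN mulmxA [_ *m Gamma]mulmxKV //.
  have -> : (E t)^T *m E t *m v t + (E t)^T *m e t =
      (E t)^T *m (E t *m (v t - v0) + s t *: d t).
    by rewrite -Ee // addrA -mulmxDr subrK -mulmxA -mulmxDr.
  by rewrite trmx_mul -!mulmxA [in LHS]mxE.
rewrite yE in var.
have dd : ((d t)^T *m (- lambda *: d t)) 0 0 = - lambda * sqnorm2 (d t).
  by rewrite -scalemxAr mxE sqnorm2E.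
rewrite dd.
have -> : lambda^-1 * (2 * (- lambda * sqnorm2 (d t))) = - (2 * sqnorm2 (d t)).
  by field; rewrite gt_eqF.
set x := E t *m (v t - v0) in var *.
have young : sqnorm2 x / 2 - sqnorm2 (d t) / 2 <= (x^T *m (x + s t *: d t)) 0 0.
  exact: sqnorm2_young (s01 t t0).
lra.
Qed.

Lemma adaptive_law_rate n k (Gamma : 'M[R]_k) (v : R -> 'cV[R]_k) (v0 : 'cV[R]_k)
    (E : R -> 'M[R]_(n, k)) (e d : R -> 'cV[R]_n) (s : R -> R) :
  let y t := - (Gamma *m ((E t)^T *m E t *m v t + (E t)^T *m e t)) in
  spd Gamma -> bounded_signal E ->
  (forall t, 0 <= t -> Pi (v t)) ->
  (forall t, 0 <= t -> 0 <= s t <= 1) ->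
  (forall t, 0 <= t -> E t *m v0 + e t = s t *: d t) ->
  exists2 c, 0 <= c & forall t j, 0 <= t ->
   grad_proj Gamma Pi (v t) (y t) j 0 ^+ 2 <=
     c * (sqnorm2 (E t *m (v t - v0)) + sqnorm2 (d t)).
Proof.
move=> y sG /bounded_signalP [M M0 EM] Pv s01 Ee.
have [Gs iG0] := spd_inv sG; have uG := spd_unitmx sG.
have [b b0 lb] := qform_coercive iG0.
have [c c0 ub] := qform_le Gamma.
pose c1 := n%:R * M; have c10 : 0 <= c1 by rewrite mulr_ge0 // ltW.
(* The factors come from [grad_proj_le], the bound on the form of [Gamma], the bound on [E^T],
   [sqnorm2D_le], and the coercivity of the inverse of [Gamma]. *)
exists (4 * c * c1 ^+ 2 * 2 / b).
  apply: divr_ge0; last exact: ltW.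
  by apply: mulr_ge0 => //; apply: mulr_ge0; [apply: mulr_ge0|exact: exprn_ge0].
move=> t j t0.
set p := grad_proj _ _ _ _; set x := E t *m (v t - v0).
pose g := (E t)^T *m (x + s t *: d t).
have yE : y t = - (Gamma *m g).
  rewrite /y /g; congr (- (_ *m _)).
  by rewrite -Ee // /x addrA -mulmxDr subrK -mulmxA -mulmxDr.
have Gy : qform (invmx Gamma) (y t) = qform Gamma g.
  by rewrite yE qformN /qform trmx_mul (proj1 sG) mulmxK // mulmxA.
have pj : p j 0 ^+ 2 <= `|p| ^+ 2.
  rewrite -(real_normK (num_real (p j 0))).
  by rewrite ler_pXn2r ?nnegrE //; exact: mx_entry_le_norm.
have pb : b * `|p| ^+ 2 <= 4 * (c * `|g| ^+ 2).
  apply: le_trans (lb p) _; apply: le_trans (grad_proj_le _ _ sG _) _.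
    by exists (v t); exact: Pv.
  by rewrite Gy; apply: ler_wpM2l => //; exact: ub.
have gx : `|g| ^+ 2 <= c1 ^+ 2 * `|x + s t *: d t| ^+ 2.
  have M0' := ltW M0; rewrite -exprMn ler_pXn2r ?nnegrE ?mulr_ge0 //.
  apply: le_trans (mx_norm_mulmx _ _) _; rewrite /c1 -mulrA; apply: ler_wpM2l => //.
  by apply: ler_wpM2r => //; rewrite mx_norm_tr; exact: EM.
have xd : `|x + s t *: d t| ^+ 2 <= 2 * (sqnorm2 x + sqnorm2 (d t)).
  exact: le_trans (norm_sqr_le _) (sqnorm2D_le _ _ (s01 t t0)).
rewrite -(ler_pM2l b0).
have bE r : b * (4 * c * c1 ^+ 2 * 2 / b * r) = 4 * (c * (c1 ^+ 2 * (2 * r))).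
  by field; rewrite gt_eqF.
rewrite bE; apply: (@le_trans _ _ (b * `|p| ^+ 2)); first by rewrite ler_pM2l.
apply: le_trans pb _; apply: ler_wpM2l => //; apply: ler_wpM2l => //.
apply: le_trans gx _; apply: ler_wpM2l => //; exact: exprn_ge0.
Qed.

End adaptive_law.

(** * Signals of affine growth and limits of closed-loop signals *)

Section closed_loop_signals.
Context {R : realType}.

Lemma vec_solution_col_mx n m (x g : R -> 'cV[R]_n) (y h : R -> 'cV[R]_m) :
  vec_solution x g -> vec_solution y h ->
  vec_solution (fun t => col_mx (x t) (y t)) (fun t => col_mx (g t) (h t)).
Proof.
move=> sx sy i; case: (split_ordP i) => j ->.
  apply: eq_ae_solution (sx j) => [t _|]; first by rewrite col_mxEu.
  by apply/funext => t; rewrite col_mxEu.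
apply: eq_ae_solution (sy j) => [t _|]; first by rewrite col_mxEd.
by apply/funext => t; rewrite col_mxEd.
Qed.

Lemma eq_persistently_exciting q (Phi Psi : R -> 'cV[R]_q) :
  (forall t, 0 <= t -> Phi t = Psi t) ->
  persistently_exciting Phi -> persistently_exciting Psi.
Proof.
move=> PP [a1 [a2 [T [a10 a20 T0 PE]]]]; exists a1, a2, T; split;
  [exact: a10|exact: a20|exact: T0|move=> t t0].
have <- : gramian Phi t T = gramian Psi t T; last exact: PE.
apply/matrixP => i j; rewrite !mxE; apply: eq_Rintegral => s.
rewrite inE /= in_itv /= => /andP[ts _].
by rewrite PP //; exact: le_trans t0 ts.
Qed.

(* Affine growth with respect to a signal that is not yet known to be bounded. *)
Definition affine_growth q n (Phi : R -> 'cV[R]_q) (x : R -> 'cV[R]_n) : Prop :=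
  exists2 c, 0 <= c & forall t, 0 <= t -> `|x t| <= c * (1 + `|Phi t|).

Lemma affine_growthD q n (Phi : R -> 'cV[R]_q) (x y : R -> 'cV[R]_n) :
  affine_growth Phi x -> affine_growth Phi y ->
  affine_growth Phi (fun t => x t + y t).
Proof.
move=> [c c0 xc] [c' c'0 yc]; exists (c + c') => [|t t0]; first exact: addr_ge0.
apply: le_trans (ler_normD _ _) _; rewrite mulrDl.
by apply: lerD; [exact: xc|exact: yc].
Qed.

Lemma affine_growthM q n p (Phi : R -> 'cV[R]_q) (M : R ->
  'M[R]_(p, n)) (x : R -> 'cV[R]_n) :
  bounded_signal M -> affine_growth Phi x -> affine_growth Phi (fun t =>
    M t *m x t).
Proof.
move=> /bounded_signalP [b b0 Mb] [c c0 xc]; exists (n%:R * (b * c)) => [|t t0].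
  by rewrite !mulr_ge0 // ltW.
apply: le_trans (mx_norm_mulmx _ _) _; rewrite -!mulrA; apply: ler_wpM2l => //.
by apply: ler_pM => //; [exact: Mb|exact: xc].
Qed.

Lemma affine_growth_bounded q n (Phi : R -> 'cV[R]_q) (x : R -> 'cV[R]_n) :
  bounded_signal x -> affine_growth Phi x.
Proof.
move=> /bounded_signalP [b b0 xb]; exists b => [|t t0]; first exact: ltW.
by apply: le_trans (xb t t0) _; rewrite ler_peMr ?(ltW b0) // lerDl.
Qed.

Lemma affine_growth_id q (Phi : R -> 'cV[R]_q) : affine_growth Phi Phi.
Proof. by exists 1 => // t _; rewrite mul1r lerDr. Qed.

Lemma affine_growth_sqnorm2 q n (Phi : R -> 'cV[R]_q) (x : R -> 'cV[R]_n) :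
  affine_growth Phi x ->
  exists2 c, 0 <= c & forall t, 0 <= t -> sqnorm2 (x t) <= c * (1 + sqnorm2
    (Phi t)).
Proof.
move=> [c c0 xc]; exists (n%:R * (2 * c ^+ 2)) => [|t t0].
  by rewrite !mulr_ge0 // exprn_ge0.
have -> : n%:R * (2 * c ^+ 2) * (1 + sqnorm2 (Phi t)) =
  n%:R * (c ^+ 2 * (2 * (1 + sqnorm2 (Phi t)))) by ring.
apply: le_trans (sqnorm2_le _) _; apply: ler_wpM2l => //.
apply: (@le_trans _ _ ((c * (1 + `|Phi t|)) ^+ 2)).
  by rewrite ler_pXn2r ?nnegrE ?mulr_ge0 ?addr_ge0 //; exact: xc.
rewrite exprMn; apply: ler_wpM2l; first exact: exprn_ge0.
apply: (@le_trans _ _ (2 * (1 + `|Phi t| ^+ 2))).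
  by have := sqr_ge0 (1 - `|Phi t|); rewrite sqrrB sqrrD; lra.
by apply: ler_wpM2l => //; rewrite lerD2l norm_sqr_le.
Qed.

Lemma eq_mx_cvgy m n (x y : R -> 'M[R]_(m, n)) M0 :
  (forall t, 0 <= t -> x t = y t) -> mx_cvg (F := +oo) x M0 ->
    mx_cvg (F := +oo) y M0.
Proof.
move=> xy cx; split=> i j; apply: cvg_trans (mx_cvgE cx i j).
apply: near_eq_cvg; near=> t; rewrite xy //; near: t; exact: nbhs_pinfty_ge.
Unshelve. all: by end_near. Qed.

Lemma mx_cvgM_bounded m n p (M : R -> 'M[R]_(m, n)) (x : R -> 'M[R]_(n, p)) :
  mx_cvg (F := +oo) M 0 -> bounded_signal x -> mx_cvg (F := +oo) (fun t =>
    M t *m x t) 0.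
Proof.
move=> M0 /bounded_signalP [b b0 xb]; split=> i j; rewrite mxE.
have cl0 l : `|M t i l| * b @[t --> +oo] --> 0 * b.
  apply: cvgM; last exact: cvg_cst.
  rewrite -(normr0 R); apply: cvg_norm.
  by have := mx_cvgE M0 i l; rewrite mxE.
have cl : \sum_l `|M t i l| * b @[t --> +oo] --> (0 : R).
  have H : \sum_l `|M t i l| * b @[t --> +oo] --> \sum_(l < n) 0 * b.
    exact: cvg_big_sum.
  by rewrite big1 in H => // l _; rewrite mul0r.
apply/cvgrPdist_le => /= e e0; move/cvgrPdist_le/(_ _ e0) in cl.
near=> t; rewrite sub0r normrN.
have : `|0 - \sum_l `|M t i l| * b| <= e by near: t.
rewrite sub0r normrN; apply: le_trans; apply: le_trans (ler_norm _).
rewrite mxE; apply: le_trans (ler_norm_sum _ _ _) _; apply: ler_sum => l _.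
rewrite normrM; apply: ler_wpM2l => //; apply: le_trans (mx_entry_le_norm _ _ _) _.
by apply: xb; near: t; exact: nbhs_pinfty_ge.
Unshelve. all: by end_near. Qed.

Lemma vec_solution_cvg_bounded n (x g : R -> 'cV[R]_n) (x0 : 'cV[R]_n) :
  vec_solution x g -> mx_cvg (F := +oo) x x0 -> bounded_signal x.
Proof.
move=> sx cx.
have bi i : exists M, forall t, 0 <= t -> `|x t i 0| <= M.
  have /cvgrPdist_le/(_ _ ltr01) [T [_ HT]] := mx_cvgE cx i 0.
  have [M M0 HM] := halfline_continuous_bounded (ae_solution_continuous (sx i))
    (normr_ge0 T).
  exists (M + `|x0 i 0| + 1) => t t0.
  have [tT|Tt] := leP t `|T|.
    have := HM t; rewrite t0 tT => /(_ isT); have := normr_ge0 (x0 i 0); lra.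
  have := HT t (le_lt_trans (ler_norm _) Tt) => H.
  rewrite -[x t i 0](subKr (x0 i 0)); apply: le_trans (ler_normB _ _) _; lra.
have [M HM] := choice bi.
apply: (@bounded_signal_entries _ _ _ _ (\sum_i `|M i|)) => t i j t0.
rewrite (ord1 j); apply: le_trans (HM i t t0) _; apply: le_trans (ler_norm _) _.
by rewrite (bigD1 i) //= lerDl; exact: sumr_ge0.
Qed.

End closed_loop_signals.

Section signal_algebra.
Context {R : realType}.

Lemma bounded_signal_sqnorm2 n (x : R -> 'cV[R]_n) (M : R) :
  (forall t, 0 <= t -> sqnorm2 (x t) <= M) -> bounded_signal x.
Proof.
move=> xM; have M0 : 0 <= M by apply: le_trans (xM 0 (lexx _)); exact: sqnorm2_ge0.
apply/bounded_signalP; exists (M + 1) => [|t t0]; first by rewrite ltr_wpDl.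
have := le_trans (norm_sqr_le _) (xM t t0); have := sqr_ge0 (1 - `|x t|).
by rewrite sqrrB; have := normr_ge0 (x t); lra.
Qed.

Lemma sqnorm2Z n (a : R) (v : 'cV[R]_n) : sqnorm2 (a *: v) = a ^+ 2 * sqnorm2 v.
Proof. by rewrite /sqnorm2 mulr_sumr; apply: eq_bigr => i _;
  rewrite mxE exprMn. Qed.

Lemma filter_energy n (lambda : R) (x y : 'cV[R]_n) : 0 <= lambda ->
  2 * (x^T *m (- lambda *: x + y)) 0 0 <= sqnorm2 x + sqnorm2 y.
Proof.
move=> l0; rewrite mxE mulr_sumr /sqnorm2 -big_split /=; apply: ler_sum => i _.
rewrite !mxE; move: (x i 0) (y i 0) => p q.
have := mulr_ge0 l0 (sqr_ge0 p); have := sqr_ge0 (p - q); rewrite sqrrB; lra.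
Qed.

Lemma affine_growth_col_mx q n m (Phi : R -> 'cV[R]_q) (x : R ->
  'cV[R]_n) (y : R -> 'cV[R]_m) :
  affine_growth Phi x -> affine_growth Phi y ->
  affine_growth Phi (fun t => col_mx (x t) (y t)).
Proof.
move=> [c c0 xc] [c' c'0 yc]; exists (c + c') => [|t t0]; first exact: addr_ge0.
have c1 : 0 <= c * (1 + `|Phi t|) by rewrite mulr_ge0 // addr_ge0.
have c2 : 0 <= c' * (1 + `|Phi t|) by rewrite mulr_ge0 // addr_ge0.
rewrite mulrDl; apply: mx_norm_le => [|i j]; first exact: addr_ge0.
case: (split_ordP i) => l ->; rewrite ?col_mxEu ?col_mxEd.
  by apply: ler_wpDr => //; apply: le_trans (mx_entry_le_norm _ _ _) (xc t t0).
by apply: ler_wpDl => //; apply: le_trans (mx_entry_le_norm _ _ _) (yc t t0).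
Qed.

Lemma sum_row_mx k n p q (c : 'I_k -> R) (A : 'I_k ->
  'M[R]_(n, p)) (B : 'I_k -> 'M[R]_(n, q)) :
  \sum_i c i *: row_mx (A i) (B i) = row_mx (\sum_i c i *: A i) (\sum_i c i *: B i).
Proof.
apply/matrixP => a b; rewrite summxE; case: (split_ordP b) => l ->.
  by rewrite row_mxEl summxE; apply: eq_bigr => i _; rewrite mxE row_mxEl mxE.
by rewrite row_mxEr summxE; apply: eq_bigr => i _; rewrite mxE row_mxEr mxE.
Qed.

Lemma mx_cvg_row_mx (T : Type) (F : set_system T) (FF : Filter F) n p q
    (X : T -> 'M[R]_(n, p)) (Y : T -> 'M[R]_(n, q)) X0 Y0 :
  mx_cvg (F := F) (fun t => row_mx (X t) (Y t)) (row_mx X0 Y0) ->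
  mx_cvg (F := F) X X0 /\ mx_cvg (F := F) Y Y0.
Proof.
move=> cXY; split; split=> i j.
  have H := mx_cvgE cXY i (lshift q j); rewrite row_mxEl in H.
  by rewrite (_ : (fun t => X t i j) = (fun t => row_mx (X t) (Y t) i (lshift q
    j)));
    [|apply/funext => t; rewrite row_mxEl].
have H := mx_cvgE cXY i (rshift p j); rewrite row_mxEr in H.
by rewrite (_ : (fun t => Y t i j) = (fun t => row_mx (X t) (Y t) i (rshift p j)));
  [|apply/funext => t; rewrite row_mxEr].
Qed.

End signal_algebra.

(** * Boundedness and tracking of the closed loop *)

Unset Implicit Arguments.
Set Strict Implicit.
Set Printing Implicit Defensive.

Theorem theorem3 (R : realType) (n m k : nat)
  (* plant, reference model, ideal gains *)
  (Ap Ar : 'M[R]_n) (Bp Br : 'M[R]_(n, m))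
  (hBp : full_column_rank Bp)
  (hAr : hurwitz Ar)
  (hmatch : exists (Kstar : 'M[R]_(m, n)) (Lstar : 'M[R]_m),
     Ap + Bp *m Kstar = Ar /\ Bp *m Lstar = Br)
  (* corners, N = k.+1, and corner gains *)
  (A : 'I_k.+1 -> 'M[R]_n) (B : 'I_k.+1 -> 'M[R]_(n, m))
  (K : 'I_k.+1 -> 'M[R]_(m, n)) (L : 'I_k.+1 -> 'M[R]_m)
  (hadm : admissible Ap Bp A B)
  (hKL : forall i, A i + B i *m K i = Ar /\ B i *m L i = Br)
  (* design constants *)
  (lambda alpha : R) (hlambda : 0 < lambda) (halpha : 0 < alpha)
  (Gamma : 'M[R]_k) (hGamma : spd Gamma)
  (* initial conditions and reference signal *)
  (xp0 xr0 : 'cV[R]_n)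
  (r : R -> 'cV[R]_m)
  (hr_pc : piecewise_continuous r) (hr_bd : bounded_signal r)
  (* closed-loop signals *)
  (xp xr phi1 z : R -> 'cV[R]_n) (u phi2 : R -> 'cV[R]_m)
  (Phi : R -> 'cV[R]_(n + m))
  (zi eps : 'I_k.+1 -> R -> 'cV[R]_n)
  (ms2 : R -> R)
  (E : R -> 'M[R]_(n, k))
  (wbar : R -> 'cV[R]_k) (w : R -> 'cV[R]_k.+1)
  (Bhat : R -> 'M[R]_(n, m)) (Khat : R -> 'M[R]_(m, n)) (Lhat : R -> 'M[R]_m)
  (* plant and reference model dynamics *)
  (hxp0 : xp 0 = xp0)
  (hxp : ae_solution xp (fun t => Ap *m xp t + Bp *m u t))
  (hxr0 : xr 0 = xr0)
  (hxr : ae_solution xr (fun t => Ar *m xr t + Br *m r t))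
  (* filters *)
  (hphi10 : phi1 0 = 0)
  (hphi1 : ae_solution phi1 (fun t => - lambda *: phi1 t + xp t))
  (hphi20 : phi2 0 = 0)
  (hphi2 : ae_solution phi2 (fun t => - lambda *: phi2 t + u t))
  (hPhi : forall t, 0 <= t -> Phi t = col_mx (phi1 t) (phi2 t))
  (hz : forall t, 0 <= t -> z t = - lambda *: phi1 t + xp t)
  (* normalized estimation errors *)
  (hzi : forall i t, 0 <= t -> zi i t = row_mx (A i) (B i) *m Phi t)
  (hms2 : forall t, 0 <= t -> ms2 t = 1 + alpha * sqnorm2 (Phi t))
  (heps : forall i t, 0 <= t -> eps i t = (ms2 t)^-1 *: (z t - zi i t))
  (hE : forall t, 0 <= t ->
     E t = \matrix_(a, j) (eps (init_ord j) t - eps ord_max t) a 0)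
  (* adaptive law *)
  (hwbar0 : (corner_simplex (R := R) (k := k))° (wbar 0))
  (hwbar : ae_solution wbar (fun t =>
     grad_proj Gamma (corner_simplex (R := R) (k := k)) (wbar t)
       (- (Gamma *m ((E t)^T *m E t *m wbar t + (E t)^T *m eps ord_max t)))))
  (hw : forall t, 0 <= t ->
     (forall j, w t (init_ord j) 0 = wbar t j 0) /\
     w t ord_max 0 = 1 - \sum_j wbar t j 0)
  (* controller *)
  (hBhat : forall t, 0 <= t -> Bhat t = \sum_i w t i 0 *: B i)
  (hKhat : forall t, 0 <= t ->
     Khat t = left_pinv (Bhat t) *m \sum_i w t i 0 *: (B i *m K i))
  (hLhat : forall t, 0 <= t ->
     Lhat t = left_pinv (Bhat t) *m \sum_i w t i 0 *: (B i *m L i))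
  (hu : forall t, 0 <= t -> u t = Khat t *m xp t + Lhat t *m r t)
  (hPE : persistently_exciting Phi) :
  [/\ bounded_signal xp, bounded_signal xr, bounded_signal u,
      bounded_signal Phi & bounded_signal z] /\
  [/\ forall i, bounded_signal (zi i), forall i, bounded_signal (eps i) &
      bounded_signal E] /\
  [/\ bounded_signal w, bounded_signal Bhat, bounded_signal Khat &
      bounded_signal Lhat] /\
  xp t - xr t @[t --> +oo] --> (0 : 'cV[R]_n).
Proof.
have sxp := ae_solution_entry hxp; have sxr := ae_solution_entry hxr.
have s1 := ae_solution_entry hphi1; have s2 := ae_solution_entry hphi2.
have sv := ae_solution_entry hwbar.
have [Kstar [Lstar [hK hL]]] := hmatch.
have [[hconv hint] hrank] := hadm.
have Pv t : 0 <= t -> corner_simplex (wbar t).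
  by apply: (corner_simplex_invariant hGamma sv); exact: interior_subset hwbar0.
have cw t : 0 <= t -> convex_weights (fun i => w t i 0).
  by move=> t0; have [wj wN] := hw t t0; exact: corner_simplex_weights (Pv t
    t0) wj wN.
have [w0 [cw0 Theta0]] : exists w0, convex_weights w0 /\
    row_mx Ap Bp = \sum_i w0 i *: row_mx (A i) (B i).
  apply: conv_hull_range_weights; have [e e0 H] := hint.
  by apply: H => //; rewrite subrr normr0.
pose v0 : 'cV[R]_k := \col_j w0 (init_ord j).
have Pv0 : corner_simplex v0 by exact: weights_corner_simplex.
(* As weights sum to one, only differences with the last corner enter the mismatch. It is [Ttil],
   not [wbar t - v0], that is shown to vanish. *)
pose N j : 'M[R]_(n, n + m) := row_mx (A (init_ord j)) (B (init_ord j)) -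
  row_mx (A ord_max) (B ord_max).
pose That t := \sum_i w t i 0 *: row_mx (A i) (B i).
pose Ttil t := \sum_j (wbar t - v0) j 0 *: N j.
have TtilE t : 0 <= t -> Ttil t = That t - row_mx Ap Bp.
  move=> t0; rewrite /That Theta0 (sum_weights_last _ (cw t t0).2).
  rewrite (sum_weights_last _ cw0.2) opprD addrACA subrr add0r -sumrB.
  by apply: eq_bigr => j _; rewrite -scalerBl !mxE (hw t t0).1.
have w01 i t : 0 <= t -> `|w t i 0| <= 1.
  move=> t0; have [w_ge0 _] := cw t t0.
  by rewrite ger0_norm; [exact: (convex_weights_le1 i (cw t t0))|exact: w_ge0].
have bw : bounded_signal w.
  by apply: (@bounded_signal_entries _ _ _ _ 1) => t i j t0; rewrite (ord1 j) w01.
have bsum p q (x : 'I_k.+1 -> 'M[R]_(p, q)) : bounded_signal (fun t =>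
  \sum_i w t i 0 *: x i).
  apply: bounded_signal_sum => i; apply: (@bounded_signalZ _ _ _ _ 1).
    by move=> t; exact: w01.
  exact: bounded_signal_cst.
have bBhat : bounded_signal Bhat by exact: eq_bounded_signal hBhat (bsum _ _ B).
have bpinv : bounded_signal (fun t => left_pinv (Bhat t)).
  have [Mp HMp] := left_pinv_bounded hrank.
  apply: (@bounded_signal_entries _ _ _ _ Mp) => t i j t0.
  apply: le_trans (mx_entry_le_norm _ _ _) _; rewrite hBhat //; apply: HMp;
    exact: cw.
have bKhat : bounded_signal Khat by exact: eq_bounded_signal hKhat
  (bounded_signalM bpinv (bsum _ _ _)).
have bLhat : bounded_signal Lhat by exact: eq_bounded_signal hLhat
  (bounded_signalM bpinv (bsum _ _ _)).
(* The filter transient [z - [Ap Bp] Phi]. *)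
pose d t := xp t + - lambda *: phi1 t + - Ap *m phi1 t + - Bp *m phi2 t.
(* [Ap *m xp] and [Bp *m u] enter once through the plant and once, with opposite sign, through the
   filters. *)
have sd : vec_solution d (fun t => - lambda *: d t).
  have H := vec_solutionD (vec_solutionD (vec_solutionD sxp (vec_solutionZ (-
    lambda) s1))
    (vec_solution_mulmx (- Ap) s1)) (vec_solution_mulmx (- Bp) s2).
  apply: eq_vec_solution H => t _; rewrite /d !mulNmx !mulmxDr -!scalemxAr.
  move: (Ap *m xp t) (Bp *m u t) (Ap *m phi1 t) (Bp *m phi2 t) => a b c e.
  by apply/colP => i; rewrite !mxE; ring.
have bd : bounded_signal d.
  apply: (@bounded_signal_sqnorm2 _ _ _ (sqnorm2 (d 0))) => t t0.
  have := ae_solution_le (sqnorm2_solution sd) (ae_solution_cst 0) (lexx 0) t0.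
  rewrite subrr subr_le0; apply => r' _.
  rewrite -scalemxAr mxE -sqnorm2E mulNr mulrN oppr_le0.
  by rewrite !mulr_ge0 ?sqnorm2_ge0 // ltW.
(* [Phi] is prescribed for nonnegative times only, while solutions are handled as total
   functions. *)
pose Phi' t := col_mx (phi1 t) (phi2 t).
have PE' : persistently_exciting Phi' by exact: eq_persistently_exciting hPhi hPE.
have sP : vec_solution Phi' (fun t => - lambda *: Phi' t + col_mx (xp t) (u t)).
  apply: eq_vec_solution (vec_solution_col_mx s1 s2) => t _.
  by rewrite scale_col_mx add_col_mx.
(* The plant state is read off the filters algebraically, so [xp] and [u] grow at most affinely in
   [Phi'] before anything but [d] and the gains is known to be bounded. *)
have xpE t : xp t = row_mx (Ap + lambda%:M) Bp *m Phi' t + d t.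
  rewrite mul_row_col mulmxDl mul_scalar_mx /d !mulNmx.
  move: (Ap *m phi1 t) (Bp *m phi2 t) => a b.
  by apply/colP => i; rewrite !mxE; ring.
have gxp : affine_growth Phi' xp.
  have -> : xp = fun t => row_mx (Ap + lambda%:M) Bp *m Phi' t + d t by
    apply/funext.
  apply: affine_growthD; last exact: affine_growth_bounded.
  by apply: affine_growthM; [exact: bounded_signal_cst|exact: affine_growth_id].
have gu : affine_growth Phi' u.
  have [c c0 H] : affine_growth Phi' (fun t => Khat t *m xp t + Lhat t *m r t).
    apply: affine_growthD; first exact: affine_growthM.
    by apply: affine_growth_bounded; exact: bounded_signalM.
  by exists c => // t t0; rewrite hu // H.
have bPhi' : bounded_signal Phi'.
  have [c c0 Hc] := affine_growth_sqnorm2 (affine_growth_col_mx gxp gu).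
  (* Here [c] accounts for the filter input and 1 for the term [|Phi'|^2] left by
     [filter_energy]. *)
  have [|t t0|M HM] := @persistently_exciting_bounded _ _ Phi' _ (c + 1) _ sP _ PE'.
  - by rewrite addr_ge0.
  - apply: le_trans (filter_energy _ _ (ltW hlambda)) _.
    have := Hc t t0; lra.
  exact: bounded_signal_sqnorm2 HM.
have bPhi : bounded_signal Phi by exact: eq_bounded_signal hPhi bPhi'.
have bxp : bounded_signal xp.
  apply: (eq_bounded_signal (fun t _ => xpE t)); apply: bounded_signalD => //.
  by apply: bounded_signalM => //; exact: bounded_signal_cst.
have bu : bounded_signal u.
  by apply: (eq_bounded_signal hu); apply: bounded_signalD; exact: bounded_signalM.
have zE t : 0 <= t -> z t = row_mx Ap Bp *m Phi' t + d t.
  move=> t0; rewrite hz // mul_row_col /d !mulNmx.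
  move: (Ap *m phi1 t) (Bp *m phi2 t) => a b.
  by apply/colP => i; rewrite !mxE; ring.
have bz : bounded_signal z.
  apply: (eq_bounded_signal zE); apply: bounded_signalD => //.
  by apply: bounded_signalM => //; exact: bounded_signal_cst.
have bzi i : bounded_signal (zi i).
  by apply: (eq_bounded_signal (hzi i)); apply: bounded_signalM => //;
    exact: bounded_signal_cst.
pose s t := (ms2 t)^-1.
have ms1 t : 0 <= t -> 1 <= ms2 t.
  by move=> t0; rewrite hms2 // lerDl mulr_ge0 ?sqnorm2_ge0 // ltW.
have s01 t : 0 <= t -> 0 <= s t <= 1.
  move=> t0; have := ms1 t t0 => H; rewrite /s invr_ge0 invf_le1 ?H ?andbT; lra.
have beps i : bounded_signal (eps i).
  apply: (eq_bounded_signal (heps i)); apply: (@bounded_signalZ _ _ _ _ 1).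
    by move=> t t0; have /andP[s0 s1'] := s01 t t0; rewrite ger0_norm.
  exact: bounded_signalB.
have bE : bounded_signal E.
  have [b b0 Hb] := bounded_family beps.
  apply: (@bounded_signal_entries _ _ _ _ (b + b)) => t i j t0.
  rewrite hE // mxE; apply: le_trans (mx_entry_le_norm _ _ _) _.
  by apply: le_trans (ler_normB _ _) _; apply: lerD; exact: Hb.
have depsE j t : 0 <= t -> eps (init_ord j) t - eps ord_max t = - s t *: (N j
  *m Phi' t).
  move=> t0; rewrite !heps // !hzi // hPhi // -/(Phi' t) /N mulmxBl.
  rewrite -scalerBr scaleNr -scalerN; congr (_ *: _).
  by rewrite !opprB addrC addrA subrK.
have ExE t (x : 'cV[R]_k) : 0 <= t -> E t *m x = - s t *: ((\sum_j x j 0 *: N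
  j) *m Phi' t).
  move=> t0; apply/colP => a; rewrite mulmx_suml scaler_sumr summxE mxE.
  apply: eq_bigr => j _; rewrite hE // mxE depsE //.
  by rewrite -scalemxAl !mxE; ring.
have Ee t : 0 <= t -> E t *m v0 + eps ord_max t = s t *: d t.
  move=> t0; rewrite ExE // heps // hzi // hPhi // -/(Phi' t) zE //.
  rewrite Theta0 (sum_weights_last _ cw0.2).
  have -> : \sum_j v0 j 0 *: N j =
      \sum_j w0 (init_ord j) *: (row_mx (A (init_ord j)) (B (init_ord j)) -
        row_mx (A ord_max) (B ord_max)).
    by apply: eq_bigr => j _; rewrite mxE.
  rewrite mulmxDl -/(s t); move: (_ *m Phi' t) (_ *m Phi' t) => a b.
  by apply/colP => i; rewrite !mxE; ring.
pose h t := sqnorm2 (E t *m (wbar t - v0)) + sqnorm2 (d t).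
have Ew t : 0 <= t -> E t *m (wbar t - v0) = - s t *: (Ttil t *m Phi' t).
  by move=> t0; rewrite ExE.
have h0 t : 0 <= t -> 0 <= h t by move=> _; apply: addr_ge0; exact: sqnorm2_ge0.
have sw := vec_solutionBc v0 sv.
have cPhi i : halfline_continuous (fun t => Phi' t i 0) by exact:
  vec_solution_continuous sP.
have ch : halfline_continuous h.
  (* For [t >= 0] this is [h], written through solutions only, so that continuity follows term by
     term. *)
  pose f t := (1 + alpha * sqnorm2 (Phi' t))^-1 * (1 + alpha * sqnorm2 (Phi'
    t))^-1 *
    (\sum_a (\sum_j (wbar t - v0) j 0 * (N j *m Phi' t) a 0) *
            (\sum_j (wbar t - v0) j 0 * (N j *m Phi' t) a 0)) + sqnorm2 (d t).
  apply: (@eq_halfline_continuous _ f) => [t t0|].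
    rewrite /f /h Ew // sqnorm2Z sqrrN /s hms2 // hPhi // expr2; congr (_ * _ + _).
    apply: eq_bigr => a _; rewrite expr2 /Ttil mulmx_suml summxE.
    by congr (_ * _); apply: eq_bigr => j _; rewrite -scalemxAl [RHS]mxE.
  apply: halfline_continuousD; last exact: ae_solution_continuous
    (sqnorm2_solution sd).
  have cs : halfline_continuous (fun t => (1 + alpha * sqnorm2 (Phi' t))^-1).
    apply: halfline_continuousV => [t _|].
      by rewrite gt_eqF // ltr_wpDr // mulr_ge0 ?sqnorm2_ge0 // ltW.
    apply: halfline_continuousD; first exact: halfline_continuous_cst.
    apply: halfline_continuousM; first exact: halfline_continuous_cst.
    exact: ae_solution_continuous (sqnorm2_solution sP).
  have cT a : halfline_continuous (fun t => \sum_j (wbar t - v0) j 0 * (N j *m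
    Phi' t) a 0).
    apply: halfline_continuous_sum => j; apply: halfline_continuousM.
      exact: vec_solution_continuous sw.
    exact: vec_solution_continuous (vec_solution_mulmx (N j) sP).
  apply: halfline_continuousM; first exact: halfline_continuousM.
  by apply: halfline_continuous_sum => a; exact: halfline_continuousM.
have [H [sH _]] := halfline_antiderivative ch.
have vH : vanishing_increments H.
  exact: (adaptive_law_energy hGamma hlambda Pv0 sv Pv s01 Ee sd sH).
have [c1 c10 rate] := adaptive_law_rate hGamma bE Pv s01 Ee.
have [b b0 msb] : exists2 b, 0 <= b & forall t, 0 <= t -> ms2 t <= b.
  have /bounded_signalP [M M0 HM] := bPhi.
  exists (1 + alpha * ((n + m)%:R * M ^+ 2)) => [|t t0].
    by rewrite addr_ge0 // !mulr_ge0 ?exprn_ge0 // ltW.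
  rewrite hms2 // lerD2l ler_pM2l //; apply: le_trans (sqnorm2_le _) _.
  by apply: ler_wpM2l => //; rewrite ler_pXn2r ?nnegrE ?HM // ltW.
have TtilC : mx_cvg (F := +oo) Ttil 0.
  (* [c1] bounds the rate of the weights; [b ^+ 2] undoes the normalization, as [Ttil t *m Phi' t]
     is [- ms2 t] times [E t *m (wbar t - v0)]. *)
  apply: (persistently_exciting_identifies (c := c1 + b ^+ 2) _ cPhi bPhi' PE'
    sw sH vH h0).
  - by rewrite addr_ge0 ?exprn_ge0.
  - move=> t j t0; apply: le_trans (rate t j t0) _.
    by apply: ler_wpM2r; rewrite ?h0 // lerDl exprn_ge0.
  - move=> t t0; have ms0 : 0 < ms2 t by apply: lt_le_trans (ms1 t t0).
    have -> : Ttil t *m Phi' t = - ms2 t *: (E t *m (wbar t - v0)).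
      by rewrite Ew // scalerA mulrNN /s divff ?scale1r // gt_eqF.
    rewrite sqnorm2Z sqrrN; apply: (@le_trans _ _ (b ^+ 2 * h t)).
      apply: ler_pM; rewrite ?sqr_ge0 ?sqnorm2_ge0 //.
        by rewrite ler_pXn2r ?nnegrE ?msb // ltW.
      by rewrite lerDl sqnorm2_ge0.
    by apply: ler_wpM2r; rewrite ?h0 // lerDr.
have ThatC : mx_cvg (F := +oo) That (row_mx Ap Bp).
  have H1 : mx_cvg (F := +oo) (fun t => Ttil t + row_mx Ap Bp) (0 + row_mx Ap Bp).
    by apply: mx_cvgD => //; exact: mx_cvg_cst.
  rewrite add0r in H1; apply: eq_mx_cvgy H1 => t t0.
  by rewrite TtilE // subrK.
have [AC BC] : mx_cvg (F := +oo) (fun t => \sum_i w t i 0 *: A i) Ap /\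
    mx_cvg (F := +oo) (fun t => \sum_i w t i 0 *: B i) Bp.
  by apply: mx_cvg_row_mx; apply: eq_mx_cvgy ThatC => t _; rewrite /That sum_row_mx.
have pinvC : mx_cvg (F := +oo) (fun t => left_pinv (Bhat t)) (left_pinv Bp).
  apply: mx_cvg_left_pinv => //; apply: eq_mx_cvgy BC => t t0; by rewrite hBhat.
have pinvBp := left_pinvK hBp.
(* Since [B i *m K i = Ar - A i] and the weights sum to one, [Khat] is [left_pinv (Bhat t)] applied
   to [Ar] minus the estimate of [Ap]; full column rank of [Bp] puts [Kstar] into the same form. *)
have KC : mx_cvg (F := +oo) Khat Kstar.
  have -> : Kstar = left_pinv Bp *m (Ar - Ap).
    by rewrite -hK addrC addKr mulmxA pinvBp mul1mx.
  have H1 : mx_cvg (F := +oo) (fun t => left_pinv (Bhat t) *m (Ar - \sum_i w t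
    i 0 *: A i))
     (left_pinv Bp *m (Ar - Ap)).
    by apply: mx_cvgM => //; apply: mx_cvgB => //; exact: mx_cvg_cst.
  apply: eq_mx_cvgy H1 => t t0; rewrite hKhat //; congr (_ *m _).
  have E1 i : A i = Ar - B i *m K i by rewrite -(hKL i).1 addrK.
  under eq_bigr do rewrite E1 scalerBr.
  by rewrite sumrB -scaler_suml (cw t t0).2 scale1r subKr.
have LC : mx_cvg (F := +oo) Lhat Lstar.
  have -> : Lstar = left_pinv Bp *m Br by rewrite -hL mulmxA pinvBp mul1mx.
  have H1 : mx_cvg (F := +oo) (fun t => left_pinv (Bhat t) *m Br) (left_pinv Bp
    *m Br).
    by apply: mx_cvgM => //; exact: mx_cvg_cst.
  apply: eq_mx_cvgy H1 => t t0; rewrite hLhat //; congr (_ *m _).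
  under eq_bigr do rewrite (hKL _).2.
  by rewrite -scaler_suml (cw t t0).2 scale1r.
pose e t := xp t + -1 *: xr t.
pose p t := Bp *m ((Khat t - Kstar) *m xp t + (Lhat t - Lstar) *m r t).
have se : vec_solution e (fun t => Ar *m e t + p t).
  apply: eq_vec_solution (vec_solutionD sxp (vec_solutionZ (-1) sxr)) => t t0.
  rewrite /e /p hu // -hK -hL !mulmxDr !mulmxBl !mulmxDl !mulmxBr !mulmxA
    -!scalemxAr.
  move: (Ap *m xp t) (Bp *m Khat t *m xp t) (Bp *m Lhat t *m r t) => a1 a2 a3.
  move: (Ap *m xr t) (Bp *m Kstar *m xp t) (Bp *m Kstar *m xr t) (Bp *m Lstar
    *m r t) => a4 a5 a6 a7.
  by apply/colP => i; rewrite !mxE; ring.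
have pC : mx_cvg (F := +oo) p 0.
  have K0 : mx_cvg (F := +oo) (fun t => Khat t - Kstar) 0.
    by rewrite -(subrr Kstar); apply: mx_cvgB => //; exact: mx_cvg_cst.
  have L0 : mx_cvg (F := +oo) (fun t => Lhat t - Lstar) 0.
    by rewrite -(subrr Lstar); apply: mx_cvgB => //; exact: mx_cvg_cst.
  have H1 : mx_cvg (F := +oo) p (Bp *m (0 + 0)).
    by apply: mx_cvgM; [exact: mx_cvg_cst|apply: mx_cvgD; exact: mx_cvgM_bounded].
  by rewrite addr0 mulmx0 in H1.
have eC := hurwitz_decay hAr se pC.
have eE : (fun t => xp t - xr t) = e by apply/funext => t; rewrite /e scaleN1r.
have be := vec_solution_cvg_bounded se eC.
(* The reference state is bounded as the difference of the plant state and the convergent tracking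
   error. *)
have bxr : bounded_signal xr.
  apply: (eq_bounded_signal _ (bounded_signalB bxp be)) => t _.
  by rewrite /e scaleN1r opprB addrC subrK.
do !split => //.
rewrite eE; exact: mx_cvgP eC.
Qed.
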